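(* Let $\{(\theta_n,S_n)\}$ be generated by the AdaGrad-Norm recursion $S_n=S_{n-1}+\|G_n\|^2$, $\theta_{n+1}=\theta_n-\frac{\alpha_0}{\sqrt{S_n}}G_n$, $n\ge1$, with deterministic $\theta_1\in\mathbb R^d$, $S_0>0$, $\alpha_0>0$. Assume that $g$ satisfies global smoothness and non-flatness at infinity, and that the oracle satisfies conditional unbiasedness, the affine conditional second-moment bound, and the local conditional relative-moment condition (all defined in the context). On the event $\mathcal A^c:=\{S_n\to\infty\}$ set $\gamma_n:=\alpha_0/\sqrt{S_n}$, $t_0:=0$, $t_n:=\sum_{i=1}^n\gamma_i$, and $m(t):=\max\{j\ge0:t_j\le t\}$. Then, for every $T>0$, $$\lim_{n\to\infty}\ \sup_{n\le k\le m(t_n+T)}\Big\|\sum_{i=n}^k\gamma_i\varepsilon_i\Big\|=0\qquad\text{almost surely on }\mathcal A^c,$$ where $\varepsilon_i:=G_i-\nabla g(\theta_i)$.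
   Context: Setting. $g:\mathbb R^d\to\mathbb R$ is continuously differentiable and bounded below, normalized so that $\inf_\theta g(\theta)=0$. $(\Omega,\mathscr F,\mathbb P)$ is a probability space with a filtration $\{\mathscr F_n\}_{n\ge0}$. For each $n\ge1$, $\theta_n$ and $S_{n-1}$ are $\mathscr F_{n-1}$-measurable, and the stochastic gradient $G_n$ (an $\mathbb R^d$-valued random vector) is $\mathscr F_n$-measurable. $\|\cdot\|$ is the Euclidean norm. Global smoothness: there is $L>0$ with $\|\nabla g(\theta)-\nabla g(\theta')\|\le L\|\theta-\theta'\|$ for all $\theta,\theta'$. Non-flatness at infinity: $\liminf_{\|\theta\|\to\infty}\|\nabla g(\theta)\|>0$. Conditional unbiasedness: $\mathbb E[G_n\mid\mathscr F_{n-1}]=\nabla g(\theta_n)$ for every $n\ge1$. Affine conditional second moment: there are constants $\beta,\sigma\ge0$ such that $\mathbb E[\|G_n\|^2\mid\mathscr F_{n-1}]\le\beta\|\nabla g(\theta_n)\|^2+\sigma^2$ for every $n\ge1$. Local conditional relative-moment condition: there exist $\delta_0,\rho>0$ and $\kappa_\rho<\infty$ such that, with $\mathcal L_n:=\{\|\nabla g(\theta_n)\|\le\delta_0\}$, almost surely for every $n$, $$\mathbf 1_{\mathcal L_n}\mathbb E[\|G_n\|^{2+\rho}\mid\mathscr F_{n-1}]\le\kappa_\rho\mathbf 1_{\mathcal L_n}\mathbb E[\|G_n\|^2\mid\mathscr F_{n-1}].$$ *)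

(* Defs.v *)
From HB Require Import structures.
From mathcomp Require Import all_boot all_order all_algebra.
From mathcomp Require Import all_classical all_reals all_analysis.
From mathcomp Require Import measurable_realfun.

Set Implicit Arguments.
Unset Strict Implicit.
Unset Printing Implicit Defensive.

Import Order.TTheory GRing.Theory Num.Theory.
Import numFieldNormedType.Exports.

Local Open Scope classical_set_scope.
Local Open Scope ring_scope.

(* The library norm on row vectors is the sup norm. *)
Definition l2norm (R : realType) (d : nat) (x : 'rV[R]_d) : R :=
  Num.sqrt (\sum_(i < d) x ord0 i ^+ 2).

Definition grad (R : realType) (d : nat) (g : 'rV[R]_d -> R) (x : 'rV[R]_d) :
    'rV[R]_d :=
  \row_(i < d) 'D_(delta_mx ord0 i) g x.

Definition C1 (R : realType) (d : nat) (g : 'rV[R]_d -> R) : Prop :=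
  (forall x, differentiable g x) /\ continuous (grad g).

(* The filter of neighbourhoods of infinity, for the limit l2norm x -> oo. *)
Definition l2_infty (R : realType) (d : nat) : set_system 'rV[R]_d :=
  [set A | exists M : R, forall x, M < l2norm x -> A x].

Definition l2_lipschitz (R : realType) (d : nat) (L : R)
    (f : 'rV[R]_d -> 'rV[R]_d) : Prop :=
  forall x y, l2norm (f x - f y) <= L * l2norm (x - y).

Definition nonflat_at_infty (R : realType) (d : nat) (g : 'rV[R]_d -> R) :
    Prop :=
  (0 < limf_einf (fun x => (l2norm (grad g x))%:E) (@l2_infty R d))%E.

Definition filtration (disp : measure_display) (Omega : measurableType disp)
    (F : nat -> set (set Omega)) : Prop :=
  [/\ forall n, sigma_algebra setT (F n),
      forall n, F n `<=` measurable &
      forall m n, (m <= n)%N -> F m `<=` F n].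

(* Measurability with respect to a sub-sigma-algebra A of Omega: when A is a
   sigma-algebra, the measurable sets of g_sigma_algebraType A are those of A. *)
Definition sub_measurable (disp disp' : measure_display)
    (Omega : measurableType disp) (U : measurableType disp')
    (A : set (set Omega)) (X : Omega -> U) : Prop :=
  measurable_fun (setT : set (g_sigma_algebraType A))
    (X : g_sigma_algebraType A -> U).

Definition sub_measurable_vec (disp : measure_display)
    (Omega : measurableType disp) (R : realType) (d : nat)
    (A : set (set Omega)) (X : Omega -> 'rV[R]_d) : Prop :=
  forall i, sub_measurable A (fun w => X w ord0 i).

(* Y is a version of E[X | A], for an integrable real random variable X. *)
Definition is_cond_exp (disp : measure_display) (Omega : measurableType disp)
    (R : realType) (P : probability Omega R) (A : set (set Omega))
    (X Y : Omega -> R) : Prop :=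
  [/\ P.-integrable setT (EFin \o X),
      sub_measurable A Y,
      P.-integrable setT (EFin \o Y) &
      forall B, A B ->
        (\int[P]_(w in B) (Y w)%:E = \int[P]_(w in B) (X w)%:E)%E].

(* The expectation of a random vector is taken coordinatewise. *)
Definition is_cond_exp_vec (disp : measure_display)
    (Omega : measurableType disp) (R : realType) (d : nat)
    (P : probability Omega R) (A : set (set Omega))
    (X Y : Omega -> 'rV[R]_d) : Prop :=
  forall i, is_cond_exp P A (fun w => X w ord0 i) (fun w => Y w ord0 i).

(* Y is a version of the [0, +oo]-valued conditional expectation E[X | A] of a
   nonnegative random variable X, which need not be integrable. *)
Definition is_cond_exp_ge0 (disp : measure_display)
    (Omega : measurableType disp) (R : realType) (P : probability Omega R)
    (A : set (set Omega)) (X : Omega -> R) (Y : Omega -> \bar R) : Prop :=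
  [/\ measurable_fun setT X /\ (forall w, 0 <= X w),
      sub_measurable A Y,
      forall w, (0 <= Y w)%E &
      forall B, A B ->
        (\int[P]_(w in B) Y w = \int[P]_(w in B) (X w)%:E)%E].

Definition stepsize (R : realType) (alpha0 : R) (S : nat -> R) (n : nat) : R :=
  alpha0 / Num.sqrt (S n).

Definition cumul (R : realType) (gamma : nat -> R) (n : nat) : R :=
  \sum_(1 <= i < n.+1) gamma i.

(* max {j >= 0 : t j <= s}, with the value +oo when that set of indices is
   unbounded. *)
Definition max_index (R : realType) (t : nat -> R) (s : R) : \bar R :=
  ereal_sup [set (j%:R)%:E | j in [set j : nat | t j <= s]].

(* sup_{n <= k <= m(t_n + T)} || sum_{i=n}^k gamma_i eps_i || *)
Definition window_sup (R : realType) (d : nat) (gamma : nat -> R)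
    (eps : nat -> 'rV[R]_d) (T : R) (n : nat) : \bar R :=
  let t := cumul gamma in
  ereal_sup [set (l2norm (\sum_(n <= i < k.+1) gamma i *: eps i))%:E
            | k in [set k : nat | (n <= k)%N /\
                                  (k%:R%:E <= max_index t (t n + T))%E]].

(* Main.v *)
Require Import Defs.
From HB Require Import structures.
From mathcomp Require Import all_boot all_order all_algebra.
From mathcomp Require Import all_classical all_reals all_analysis.
From mathcomp Require Import measurable_realfun.
From mathcomp Require Import ring lra.

Set Implicit Arguments.
Unset Strict Implicit.
Unset Printing Implicit Defensive.

Import Order.TTheory GRing.Theory Num.Theory.
Import numFieldNormedType.Exports HBNNSimple.

Local Open Scope classical_set_scope.
Local Open Scope ring_scope.

(** Write a_n for 1/sqrt(S_n), which is known before G_(n+1), whereas the step taken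
    with G_(n+1) is alpha0 a_(n+1).  The noise would be a martingale difference if
    a_n took the place of a_(n+1); the difference a_n - a_(n+1) telescopes, and it
    is at most a_n^3 |G_(n+1)|^2.  The windows have bounded length on the scale of
    the step sizes, so it is enough that the noise averages out on that scale.

    Energy.  The Lyapunov function a_n g + alpha0 beta a_n^2 |grad g|^2 decreases
    in mean by a multiple of a_n^2 |grad g|^2, up to a multiple of a_n - a_(n+1)
    ([energy_step]).  Summed along a path, this bounds the expectation of the sum of
    a_n^2 |grad g|^2 ([energy_summable]).

    Far from critical points, where |grad g| > delta0, the affine variance bound is
    a multiple of |grad g|^2, so that the noise is square summable
    ([far_summable]).  Near critical points only a power a_n^(2+r) |G|^2 with
    0 < r <= 1 is summable: the part with a_n |G| <= 1 is bounded by the decrease of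
    a_n^r, and by the local moment condition the jumps with a_n |G| > 1 carry at
    most half of the conditional second moment once a_n is small
    ([near_summable2]).  Hence the near noise can be truncated at a_n |G| = 1, and
    the fourth powers of the truncated noise are summable in mean.

    Averages.  Let Z forget the past at the rate of the steps,
    Z_(n+1) = (1 - a_n) Z_n + xi_n ([forget]).  The sum of xi over a window is then
    the increment of Z plus the sum of a_n Z_n, which is small as soon as Z tends to
    zero ([window_forget]).  A Robbins-Siegmund argument ([robbins_siegmund]) shows
    that Z tends to zero wherever the sum of a_n is infinite: it applies to Z^2 for
    the far noise and to Z^4 for the truncated near noise ([near_avg_cvg0]).  The
    second power would not do for the latter: its error a_n^2 |G|^2 need not be
    summable, while in the fourth power it comes with the factor Z^2, which is
    absorbed by the drift a_n Z^4 unless Z^2 is of order a_n, and then a_n^3 |G|^2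
    is summable.

    Finally the sum of a_n is infinite where S tends to infinity
    ([clock_diverges]): otherwise the sum of a_n^2 |G|^2 would be finite, and S is
    multiplied at each step by 1 + a_n^2 |G|^2. *)

(** * Integration against test functions of a sub-sigma-algebra *)

Section SubSigmaAlgebra.
Context (R : realType) (disp : measure_display) (Omega : measurableType disp).
Implicit Types (A : set (set Omega)) (f g : Omega -> R).

Lemma sub_measurableW (disp' : measure_display) (U : measurableType disp') A
    (f : Omega -> U) :
  sigma_algebra setT A -> A `<=` measurable ->
  sub_measurable A f -> measurable_fun setT f.
Proof.
move=> sA Am mf _ Y mY; apply: Am; have := mf measurableT _ mY.
by rewrite (measurable_g_measurableTypeE sA).
Qed.

Lemma integrable_addr (P : probability Omega R) f g :
  P.-integrable setT (fun w => (f w)%:E) -> P.-integrable setT (fun w => (g w)%:E) ->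
  P.-integrable setT (fun w => (f w + g w)%:E).
Proof. by move=> intf intg; exact: (integrableD measurableT intf intg). Qed.

Lemma sub_measurable_le (disp' : measure_display) (U : measurableType disp') A B
    (f : Omega -> U) :
  sigma_algebra setT A -> sigma_algebra setT B -> A `<=` B ->
  sub_measurable A f -> sub_measurable B f.
Proof.
move=> sA sB AB mf _ Y mY; rewrite (measurable_g_measurableTypeE sB).
by apply: AB; have := mf measurableT _ mY; rewrite (measurable_g_measurableTypeE sA).
Qed.

Lemma sub_measurable_approx A (Z : Omega -> R) :
  sigma_algebra setT A -> sub_measurable A Z -> (forall w, 0 <= Z w) ->
  exists k : nat -> Omega -> R,
    [/\ forall n w, 0 <= k n w,
        forall n, finite_set (range (k n)),
        forall n, sub_measurable A (k n),
        forall w m n, (m <= n)%N -> k m w <= k n w &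
        forall w, (k n w)%:E @[n --> \oo] --> (Z w)%:E].
Proof.
move=> sA mZ Z0.
have EZ : measurable_fun (setT : set (g_sigma_algebraType A)) (EFin \o Z).
  exact/measurable_EFinP.
have [h [ndh cvgh]] := approximation measurableT EZ (fun w _ => Z0 w).
exists (fun n w => h n w); split.
- by move=> n w; exact: fun_ge0.
- by move=> n; exact: (@fimfunP _ _ (h n)).
- by move=> n; exact: (measurable_funPT (h n)).
- by move=> w m n /ndh /lefP; exact.
- by move=> w; exact: (cvgh w).
Qed.

(** The defining inequality of conditional expectations, tested on sets, extends
    to nonnegative test functions: approximate them by simple functions. *)
Lemma test_le (P : {measure set Omega -> \bar R}) A (X Y Z : Omega -> R) :
  sigma_algebra setT A -> A `<=` measurable ->
  measurable_fun setT X -> measurable_fun setT Y ->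
  (forall w, 0 <= X w) -> (forall w, 0 <= Y w) ->
  (forall B, A B -> (\int[P]_(w in B) (X w)%:E <= \int[P]_(w in B) (Y w)%:E)%E) ->
  sub_measurable A Z -> (forall w, 0 <= Z w) ->
  (\int[P]_w (Z w * X w)%:E <= \int[P]_w (Z w * Y w)%:E)%E.
Proof.
move=> sA Am mX mY X0 Y0 XY mZ Z0.
have [k [k0 fk smk ndk cvgk]] := sub_measurable_approx sA mZ Z0.
have kE n w : k n w = \sum_(y \in range (k n)) y * \1_(k n @^-1` [set y]) w.
  rewrite (fsbigD1 (k n w)) //=; last by exists w.
  rewrite indicE mem_set // mulr1 fsbig1 ?addr0 //.
  by move=> y [_ /= /nesym ykw]; rewrite indicE memNset ?mulr0.
have mk n : measurable_fun setT (k n) by exact: (sub_measurableW sA).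
have mpre n y : A (k n @^-1` [set y]).
  have := smk n measurableT _ (measurable_set1 y).
  by rewrite setTI (measurable_g_measurableTypeE sA).
have ind0 n y w : y < 0 -> \1_(k n @^-1` [set y]) w = 0 :> R.
  move=> y0; rewrite indicE memNset //= => kw.
  by have := k0 n w; rewrite kw leNgt y0.
have mind n y : measurable_fun setT (\1_(k n @^-1` [set y]) : Omega -> R).
  by apply: measurable_indic; exact: Am.
have simple (W : Omega -> R) n : measurable_fun setT W -> (forall w, 0 <= W w) ->
    (\int[P]_w (k n w * W w)%:E =
     \sum_(y \in range (k n)) (y%:E * \int[P]_w (\1_(k n @^-1` [set y]) w * W w)%:E))%E.
  move=> mW W0.
  rewrite (eq_integral (fun w =>
    \sum_(y \in range (k n)) (y * (\1_(k n @^-1` [set y]) w * W w))%:E))%E; last first.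
    move=> w _; rewrite kE fsumEFin // mulr_fsuml; congr (_%:E).
    by apply: eq_fsbigr => y _; rewrite mulrA.
  rewrite ge0_integral_fsum //=; first last.
  - move=> y w _; rewrite lee_fin; have [y0|y0] := leP 0 y.
      by rewrite !mulr_ge0.
    by rewrite ind0 // mul0r mulr0.
  - move=> y; apply/measurable_EFinP.
    by apply: measurable_funM => //; apply: measurable_funM.
  apply: eq_fsbigr => y _; under eq_integral do rewrite EFinM.
  have [y0|y0] := leP 0 y.
    rewrite ge0_integralZl_EFin //=.
      by move=> w _; rewrite lee_fin mulr_ge0.
    by apply/measurable_EFinP; apply: measurable_funM.
  have z w : ((\1_(k n @^-1` [set y]) w * W w)%:E = 0)%E by rewrite ind0 // mul0r.
  under eq_integral do rewrite z mule0.
  by under [in RHS]eq_integral do rewrite z; rewrite !integral0 mule0.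
have lim (W : Omega -> R) : measurable_fun setT W -> (forall w, 0 <= W w) ->
    (\int[P]_w (k n w * W w)%:E)%E @[n --> \oo] --> (\int[P]_w (Z w * W w)%:E)%E.
  move=> mW W0.
  have -> : (\int[P]_w (Z w * W w)%:E = \int[P]_w limn (fun n => (k n w * W w)%:E))%E.
    apply: eq_integral => w _; apply/esym/cvg_lim => //=.
    under eq_fun do rewrite mulrC EFinM; rewrite mulrC EFinM.
    by apply: cvgeZl => //; exact: cvgk.
  apply: (@cvg_monotone_convergence _ _ _ _ _ _ (fun n w => (k n w * W w)%:E)) => //.
  - by move=> n; apply/measurable_EFinP; apply: measurable_funM.
  - by move=> n w _; rewrite lee_fin mulr_ge0.
  - move=> w _ m n mn; rewrite lee_fin ler_wpM2r //.
    exact: ndk.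
apply: (lee_cvg_to (lim X mX X0) (lim Y mY Y0)).
apply: nearW => n; rewrite !simple // !fsbig_finite //=.
apply: lee_sum => y _; have [y0|y0] := leP 0 y; last first.
  have z (W : Omega -> R) w : ((\1_(k n @^-1` [set y]) w * W w)%:E = 0)%E.
    by rewrite ind0 // mul0r.
  under eq_integral do rewrite z.
  by under [in leRHS]eq_integral do rewrite z.
have restr (W : Omega -> R) :
    (\int[P]_w (\1_(k n @^-1` [set y]) w * W w)%:E =
     \int[P]_(w in k n @^-1` [set y]) (W w)%:E)%E.
  rewrite [RHS]integral_mkcond; apply: eq_integral => w _.
  rewrite patchE indicE; case: ifPn => _; first by rewrite mul1r.
  by rewrite mul0r.
by rewrite lee_wpmul2l // !restr; exact: XY.
Qed.

(** Reduced to nonnegative test functions, because Z is the difference of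
    |Z| + Z and |Z|, and then to nonnegative X and Y, because D = |X| + |Y| may be
    added to both. *)
Lemma test_eq (P : probability Omega R) A (X Y Z : Omega -> R) :
  sigma_algebra setT A -> A `<=` measurable -> is_cond_exp P A X Y ->
  sub_measurable A Z ->
  P.-integrable setT (fun w => (Z w * X w)%:E) ->
  P.-integrable setT (fun w => (Z w * Y w)%:E) ->
  (\int[P]_w (Z w * X w)%:E = \int[P]_w (Z w * Y w)%:E)%E.
Proof.
move=> sA Am [iX sY iY XY].
have mX : measurable_fun setT X by apply/measurable_EFinP/(measurable_int _ iX).
have mY : measurable_fun setT Y by exact: (sub_measurableW sA).
pose D w := `|X w| + `|Y w|.
have mD : measurable_fun setT D by apply: measurable_funD; exact: measurableT_comp.
have iD : P.-integrable setT (EFin \o D).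
  by apply: integrable_addr; exact: integrable_norm.
have addD B : A B -> forall W, P.-integrable setT (EFin \o W) ->
    (\int[P]_(w in B) (W w + D w)%:E =
     \int[P]_(w in B) (W w)%:E + \int[P]_(w in B) (D w)%:E)%E.
  move=> AB W iW; have mB := Am _ AB.
  by apply: integralD_EFin => //; apply: (integrableS measurableT).
have XD0 w : 0 <= X w + D w.
  by have := ler_norm (- X w); have := normr_ge0 (Y w); rewrite normrN /D; lra.
have YD0 w : 0 <= Y w + D w.
  by have := ler_norm (- Y w); have := normr_ge0 (X w); rewrite normrN /D; lra.
have pos (W : Omega -> R) : sub_measurable A W -> (forall w, 0 <= W w) ->
    P.-integrable setT (fun w => (W w * X w)%:E) ->
    P.-integrable setT (fun w => (W w * Y w)%:E) ->
    (\int[P]_w (W w * X w)%:E = \int[P]_w (W w * Y w)%:E)%E.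
  move=> sW W0 iWX iWY.
  have iWD : P.-integrable setT (EFin \o (fun w => W w * D w)).
    rewrite (_ : _ \o _ = fun w => ((`|W w * X w| + `|W w * Y w|)%:E)).
      by apply: integrable_addr; exact: integrable_norm.
    by apply/funext => w /=; rewrite !normrM (ger0_norm (W0 w)) -mulrDr.
  have eqD : (\int[P]_w (W w * (X w + D w))%:E = \int[P]_w (W w * (Y w + D w))%:E)%E.
    apply/eqP; rewrite eq_le; apply/andP; split; apply: (test_le sA) => //;
      try exact: measurable_funD; move=> B AB; rewrite !addD // XY //.
  move: eqD; under eq_integral do rewrite mulrDr EFinD.
  under [in RHS]eq_integral do rewrite mulrDr EFinD.
  rewrite !integralD //.
  have fin (V : Omega -> R) : P.-integrable setT (fun w => (V w)%:E) ->
    (\int[P]_w (V w)%:E)%E \is a fin_num by exact: integrable_fin_num.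
  rewrite -(fineK (fin _ iWX)) -(fineK (fin _ iWY)) -(fineK (fin _ iWD)) -!EFinD.
  by move=> H; have {}H := EFin_inj H; congr EFin; apply: addIr H.
move=> sZ iZX iZY.
have sN : sub_measurable A (fun w => `|Z w|) by exact: measurableT_comp.
have sZN : sub_measurable A (fun w => `|Z w| + Z w) by exact: measurable_funD.
have iN (W : Omega -> R) : measurable_fun setT W ->
    P.-integrable setT (fun w => (Z w * W w)%:E) ->
    P.-integrable setT (fun w => (`|Z w| * W w)%:E).
  move=> mW; apply: le_integrable => //.
    apply/measurable_EFinP; apply: measurable_funM => //.
    exact: (sub_measurableW sA).
  by move=> w _; rewrite !abse_EFin lee_fin !normrM normr_id.
have split (W : Omega -> R) : measurable_fun setT W ->
    P.-integrable setT (fun w => (Z w * W w)%:E) ->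
    (\int[P]_w ((`|Z w| + Z w) * W w)%:E =
     \int[P]_w (`|Z w| * W w)%:E + \int[P]_w (Z w * W w)%:E)%E.
  move=> mW iW; rewrite -integralD //; last exact: iN.
  by apply: eq_integral => w _; rewrite mulrDl.
have iS (W : Omega -> R) : measurable_fun setT W ->
    P.-integrable setT (fun w => (Z w * W w)%:E) ->
    P.-integrable setT (fun w => ((`|Z w| + Z w) * W w)%:E).
  move=> mW iW; under eq_fun do rewrite mulrDl.
  by apply: integrable_addr => //; exact: iN.
have nn w : 0 <= `|Z w| + Z w by have := ler_norm (- Z w); rewrite normrN; lra.
have := pos _ sZN nn (iS _ mX iZX) (iS _ mY iZY).
rewrite !split // (pos _ sN) //; try exact: iN.
have fin (V : Omega -> R) : P.-integrable setT (fun w => (V w)%:E) ->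
  (\int[P]_w (V w)%:E)%E \is a fin_num by exact: integrable_fin_num.
rewrite -(fineK (fin _ iZX)) -(fineK (fin _ iZY)) -(fineK (fin _ (iN _ mY iZY))) -!EFinD.
by move=> H; have {}H := EFin_inj H; congr EFin; apply: addrI H.
Qed.

End SubSigmaAlgebra.

(** * Summability and a Robbins-Siegmund type lemma *)

Section Summability.
Context (R : realType).

(** For nonnegative terms this is convergence of the series. *)
Definition bsum (u : nat -> R) := exists M, forall n, \sum_(i < n) u i <= M.

Definition bsume (u : nat -> \bar R) :=
  exists M : R, forall n, (\sum_(i < n) u i <= M%:E)%E.

Lemma bsum_le (u v : nat -> R) (C : R) : 0 <= C ->
  (forall n, u n <= C * v n) -> bsum v -> bsum u.
Proof.
move=> C0 uv [M HM]; exists (C * M) => n.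
apply: (le_trans _ (ler_wpM2l C0 (HM n))).
by rewrite mulr_sumr; apply: ler_sum => i _; exact: uv.
Qed.

Lemma bsumD (u v : nat -> R) : bsum u -> bsum v -> bsum (fun n => u n + v n).
Proof.
move=> [M HM] [N HN]; exists (M + N) => n.
rewrite big_split /=; exact: (lerD (HM n) (HN n)).
Qed.

Lemma bsum_le_eventually (u v : nat -> R) N :
  (forall n, 0 <= v n) -> (forall n, (N <= n)%N -> u n <= v n) -> bsum v -> bsum u.
Proof.
move=> v0 uv [M HM]; exists (\sum_(i < N) `|u i| + M) => n.
apply: (@le_trans _ _ (\sum_(i < n) ((if (i < N)%N then `|u i| else 0) + v i))).
  apply: ler_sum => i _; have [iN|Ni] := ltnP i N.
    by apply: ler_wpDr => //; exact: ler_norm.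
  by rewrite add0r uv.
rewrite big_split /=; apply: lerD (HM n).
rewrite -(big_mkord xpredT (fun i => if (i < N)%N then `|u i| else 0)).
rewrite -(big_mkord xpredT (fun i => `|u i|)).
have [nN|Nn] := leqP n N.
  rewrite [leRHS](big_cat_nat (leq0n n) nN) /= ler_wpDr ?sumr_ge0 //.
  apply: ler_sum_nat => i /andP[_ ni].
  by rewrite (leq_trans ni nN).
rewrite (big_cat_nat (leq0n N) (ltnW Nn)) /= ler_wnDr //.
  by rewrite big_nat big1 // => i /andP[Ni _]; rewrite ltnNge Ni.
by apply: ler_sum_nat => i /andP[_ ->].
Qed.

Lemma bsum_tail (u : nat -> R) (e : R) : (forall n, 0 <= u n) -> bsum u -> 0 < e ->
  exists N, forall m n, (N <= m)%N -> \sum_(m <= i < n) u i <= e.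
Proof.
move=> u0 [M HM] e0.
pose s n := \sum_(i < n) u i.
have nds : nondecreasing_seq s.
  by apply/nondecreasing_seqP => n; rewrite /s big_ord_recr /= lerDl.
have cs : cvgn s.
  apply: nondecreasing_is_cvgn => //; exists M => _ [n _ <-]; exact: HM.
have /cvgrPdist_le /(_ _ e0) [N _ HN] := cs.
exists N => m n Nm.
have [mn|nm] := leqP m n; last by rewrite big_geq ?ltW // ltnW.
have -> : \sum_(m <= i < n) u i = s n - s m.
  by rewrite /s -!(big_mkord xpredT u) (big_cat_nat (leq0n m) mn) /= addrAC subrr add0r.
have := HN m Nm; have := nondecreasing_cvgn_le nds cs n.
rewrite /= => h1; rewrite ler_norml => /andP[_ h2]; lra.
Qed.

Lemma bsum_cvg0 (u : nat -> R) (e : R) : (forall n, 0 <= u n) -> bsum u -> 0 < e ->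
  exists N, forall m, (N <= m)%N -> u m <= e.
Proof.
move=> u0 su e0; have [N HN] := bsum_tail u0 su e0.
by exists N => m Nm; have := HN m m.+1 Nm; rewrite big_nat1.
Qed.

Lemma bsume_le (u v : nat -> \bar R) (C : R) : 0 <= C -> (forall n, (0 <= v n)%E) ->
  (forall n, (u n <= C%:E * v n)%E) -> bsume v -> bsume u.
Proof.
move=> C0 v0 uv [M HM]; exists (C * M) => n.
rewrite EFinM; apply: (@le_trans _ _ (C%:E * \sum_(i < n) v i)%E).
  by rewrite ge0_sume_distrr //; exact: lee_sum.
by apply: lee_wpmul2l; rewrite ?lee_fin.
Qed.

Lemma bsumeD (u v : nat -> \bar R) : bsume u -> bsume v -> bsume (fun n => u n + v n)%E.
Proof.
move=> [M HM] [N HN]; exists (M + N) => n.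
by rewrite big_split /= EFinD; exact: (leeD (HM n) (HN n)).
Qed.

Lemma bsume_telescope (V q e : nat -> \bar R) :
  (forall n, 0 <= V n)%E -> (V 0%N < +oo)%E ->
  (forall n, V n.+1 + q n <= V n + e n)%E -> bsume e -> bsume q.
Proof.
move=> V0 Vfin step [M HM].
have V0f : V 0%N \is a fin_num by rewrite ge0_fin_numE.
exists (fine (V 0%N) + M) => n.
have H k : (V k + \sum_(i < k) q i <= V 0%N + \sum_(i < k) e i)%E.
  elim: k => [|k IH]; first by rewrite !big_ord0.
  rewrite !big_ord_recr /= (addeC (\sum_(i < k) q i)%E) addeA.
  apply: (le_trans (leeD (step k) (lexx _))).
  by rewrite addeAC (addeA (V 0%N)); apply: leeD.
apply: le_trans (_ : _ <= V n + \sum_(i < n) q i)%E _; first by rewrite leeDr.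
by apply: (le_trans (H n)); rewrite EFinD fineK // leeD.
Qed.

Lemma bsume_telescope0 (V q : nat -> \bar R) :
  (forall n, 0 <= V n)%E -> (V 0%N < +oo)%E -> (forall n, V n.+1 + q n <= V n)%E -> bsume q.
Proof.
move=> V0 Vfin step; apply: (bsume_telescope V0 Vfin (e := fun=> 0%E)).
  by move=> n; rewrite adde0.
by exists 0 => n; rewrite big1.
Qed.

End Summability.

(* The lock keeps unification from looking for sums inside the integral. *)
Fact mean_key : unit. Proof. exact: tt. Qed.

Section AlmostSureSummability.
Context (R : realType) (disp : measure_display) (Omega : measurableType disp)
  (P : probability Omega R).

(** Expectation of a nonnegative real random variable, possibly infinite. *)
Definition mean (f : Omega -> R) : \bar R :=
  locked_with mean_key (\int[P]_w (f w)%:E)%E.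

Lemma meanE (f : Omega -> R) : mean f = (\int[P]_w (f w)%:E)%E.
Proof. by rewrite /mean unlock. Qed.

Lemma eq_mean (f g : Omega -> R) : f =1 g -> mean f = mean g.
Proof. by move=> fg; rewrite !meanE; apply: eq_integral => w _; rewrite fg. Qed.

Lemma mean_ge0 (f : Omega -> R) : (forall w, 0 <= f w) -> (0 <= mean f)%E.
Proof. by move=> f0; rewrite meanE; apply: integral_ge0 => w _; rewrite lee_fin. Qed.

Lemma mean_le (f g : Omega -> R) : measurable_fun setT f -> measurable_fun setT g ->
  (forall w, 0 <= f w) -> (forall w, f w <= g w) -> (mean f <= mean g)%E.
Proof.
move=> mf mg f0 fg; rewrite !meanE.
apply: ge0_le_integral => //; try by move=> w _; rewrite lee_fin.
- exact/measurable_EFinP.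
- exact/measurable_EFinP.
Qed.

Lemma meanD (f g : Omega -> R) : measurable_fun setT f -> measurable_fun setT g ->
  (forall w, 0 <= f w) -> (forall w, 0 <= g w) ->
  mean (fun w => f w + g w) = (mean f + mean g)%E.
Proof.
move=> mf mg f0 g0; rewrite !meanE -ge0_integralD //; try by move=> w _; rewrite lee_fin.
- exact/measurable_EFinP.
- exact/measurable_EFinP.
Qed.

Lemma meanZ (k : R) (f : Omega -> R) : measurable_fun setT f -> 0 <= k ->
  (forall w, 0 <= f w) -> mean (fun w => k * f w) = (k%:E * mean f)%E.
Proof.
move=> mf k0 f0; rewrite !meanE -ge0_integralZl_EFin //.
- by move=> w _; rewrite lee_fin.
- exact/measurable_EFinP.
Qed.

Lemma mean_cst (k : R) : mean (fun=> k) = k%:E.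
Proof. by rewrite meanE integral_cst //= probability_setT mule1. Qed.

Lemma bsume_ae (f : nat -> Omega -> R) :
  (forall n, measurable_fun setT (f n)) -> (forall n w, 0 <= f n w) ->
  bsume (fun n => mean (f n)) -> {ae P, forall w, bsum (f ^~ w)}.
Proof.
move=> mf f0 [M HM].
have mEf n : measurable_fun setT (fun w => (f n w)%:E) by exact/measurable_EFinP.
pose s w := (\sum_(0 <= n <oo) (f n w)%:E)%E.
have s0 w : (0 <= s w)%E by apply: nneseries_ge0 => n _ _; rewrite lee_fin.
have ms : measurable_fun setT s.
  by apply: ge0_emeasurable_sum => // n w _ _; rewrite lee_fin.
have is_ : P.-integrable setT s.
  apply/integrableP; split => //.
  under eq_integral do rewrite gee0_abs //.
  rewrite integral_nneseries //; last by move=> n w _; rewrite lee_fin.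
  under eq_eseriesr do rewrite -meanE.
  apply: (@le_lt_trans _ _ M%:E); last exact: ltry.
  apply: lime_le.
    by apply: is_cvg_nneseries => n _ _; exact: mean_ge0.
  by apply: nearW => n; rewrite big_mkord.
have [N [mN N0 HN]] := integrable_ae measurableT is_.
exists N; split => //; apply: subset_trans HN => w /= nb fin; apply: nb.
exists (fine (s w)) => n; rewrite -lee_fin fineK; last exact: fin.
rewrite -sumEFin -(big_mkord xpredT (fun i => (f i w)%:E)).
by apply: nneseries_lim_ge => k _; rewrite lee_fin.
Qed.

(** Almost sure convergence of an almost-supermartingale with drift c X; the
    conditional inequality is expressed through test functions phi.  On the
    paths where the clock c has infinite mass the drift forces small values of X
    infinitely often, and the upcrossing argument shows that the level 2 eta is
    reached only finitely often after a visit below eta. *)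
Section RobbinsSiegmund.
Variables (F : nat -> set (set Omega)) (X c : nat -> Omega -> R) (e : nat -> \bar R).
Hypothesis filt : filtration F.
Hypothesis X0 : forall n w, 0 <= X n w.
Hypothesis c0 : forall n w, 0 <= c n w.
Hypothesis mX : forall n, sub_measurable (F n) (X n).
Hypothesis mc : forall n, sub_measurable (F n) (c n).
Hypothesis drift : forall n (phi : Omega -> R), sub_measurable (F n) phi ->
  (forall w, 0 <= phi w <= 1) ->
  (mean (fun w => phi w * X n.+1 w)%R + mean (fun w => phi w * (c n w * X n w))%R
   <= mean (fun w => phi w * X n w)%R + e n)%E.
Hypothesis X_init : (mean (X 0%N) < +oo)%E.
Hypothesis e_sum : bsume e.

Let smW n (d' : measure_display) (U : measurableType d') (f : Omega -> U) :
  sub_measurable (F n) f -> measurable_fun setT f.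
Proof. by move=> mf; have [sF Fm _] := filt; exact: (sub_measurableW (sF n) (@Fm n)). Qed.

Lemma rs_drift_summable : {ae P, forall w, bsum (fun n => c n w * X n w)}.
Proof.
apply: bsume_ae => [n|n w|].
- by apply: measurable_funM; exact: smW.
- exact: mulr_ge0.
apply: (@bsume_telescope _ (fun n => mean (X n)) _ e) => //.
  by move=> n; exact: mean_ge0.
move=> n; have := @drift n (fun=> 1) (measurable_cst _).
do 3 rewrite (eq_mean (fun w => mul1r _)).
by apply=> w; rewrite ler01 lexx.
Qed.

Section Upcrossing.
Variables (eta : R) (eta0 : 0 < eta).

(** The running crossing: X has been below eta and has not exceeded 2 eta since. *)
Fixpoint low n : Omega -> bool := match n with
  | 0 => fun w => X 0%N w <= eta
  | m.+1 => fun w => (X m.+1 w <= eta) || low m w && (X m.+1 w < 2 * eta)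
  end.

Let mlow n : sub_measurable (F n) (low n).
Proof.
have [sF _ Fle] := filt.
elim: n => [|n IH] /=.
  exact: (measurable_fun_ler (@mX 0%N) (measurable_cst _)).
apply: measurable_or.
  exact: (measurable_fun_ler (@mX n.+1) (measurable_cst _)).
apply: measurable_and; last first.
  exact: (measurable_fun_ltr (@mX n.+1) (measurable_cst _)).
by apply: (sub_measurable_le (sF n)) IH => //; exact: Fle.
Qed.

Lemma low_lt n w : low n w -> X n w < 2 * eta.
Proof.
have e2 : eta < 2 * eta by have := eta0; lra.
case: n => [|n] /=; first by move/le_lt_trans; exact.
by case/orP => [/le_lt_trans|/andP[]//]; exact.
Qed.

(** The potential psi is X during a crossing and eta outside.  It satisfies the same
    almost-supermartingale inequality as X, and it drops by eta at each exit through
    2 eta, so that the expected number of exits is finite. *)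
Lemma rs_finite_crossings :
  {ae P, forall w, exists N, forall n, (N <= n)%N -> low n w -> X n.+1 w < 2 * eta}.
Proof.
have [sF Fm Fle] := filt.
pose U n w : R := if low n w && (2 * eta <= X n.+1 w) then 1 else 0.
have U0 n w : 0 <= U n w by rewrite /U; case: ifP.
pose h n w : R := if low n w then 1 else 0.
have sh n : sub_measurable (F n) (h n).
  by apply: measurable_fun_ifT => //; exact: mlow.
pose psi n w := if low n w then X n w else eta.
have psi0 n w : 0 <= psi n w by rewrite /psi; case: ifP => // _; exact: ltW.
have mpsi n : measurable_fun setT (psi n).
  by apply: (@smW n); apply: (measurable_fun_ifT (@mlow n) (@mX n)); exact: measurable_cst.
have mU n : measurable_fun setT (U n).
  apply: (@smW n.+1); apply: measurable_fun_ifT; try exact: measurable_cst.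
  apply: measurable_and; last exact: (measurable_fun_ler (measurable_cst _) (@mX n.+1)).
  by apply: (sub_measurable_le (sF n)) (@mlow n) => //; exact: Fle.
have : {ae P, forall w, bsum (fun n => eta * U n w)}.
  apply: bsume_ae => [n|n w|].
  - exact: measurable_funM.
  - by rewrite mulr_ge0 // ltW.
  apply: (@bsume_telescope _ (fun n => mean (psi n)) _ e) => //.
  - by move=> n; exact: mean_ge0.
  - apply: (@le_lt_trans _ _ (mean (fun=> eta))); last by rewrite mean_cst ltry.
    apply: mean_le => // w; rewrite /psi /=; by case: ifP.
  move=> n.
  have mX1 k : measurable_fun setT (X k) by exact: (@smW k).
  have mh k : measurable_fun setT (h k) by exact: (@smW k).
  have h0 w : 0 <= h n w by rewrite /h; case: ifP.
  have h1 w : 0 <= 1 - h n w by rewrite /h; case: ifP; rewrite ?subrr ?subr0.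
  have splitE (W : Omega -> R) : measurable_fun setT W -> (forall w, 0 <= W w) ->
    mean (fun w => if low n w then W w else eta) =
    (mean (fun w => h n w * W w)%R + mean (fun w => (1 - h n w) * eta)%R)%E.
    move=> mW W0; rewrite -meanD //.
    - apply: eq_mean => w.
      by rewrite /h; case: ifP => _; rewrite ?mul1r ?subrr ?mul0r ?subr0 ?addr0 ?add0r ?mul1r.
    - exact: measurable_funM.
    - by apply: measurable_funM => //; apply: measurable_funB.
    - by move=> w; rewrite mulr_ge0.
    - by move=> w; rewrite mulr_ge0 // ltW.
  apply: (@le_trans _ _ (mean (fun w => if low n w then X n.+1 w else eta))).
    rewrite -meanD //; last by move=> w; rewrite mulr_ge0 // ltW.
      apply: mean_le => //.
      + by apply: measurable_funD => //; apply: measurable_funM.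
      + by apply: measurable_fun_ifT => //; apply: (@smW n); exact: mlow.
      + by move=> w; rewrite addr_ge0 // mulr_ge0 // ltW.
      move=> w; rewrite /psi /U /=.
      case: (low n w) => /=; rewrite ?orbF.
        case: (leP (2 * eta) (X n.+1 w)) => h2; rewrite ?orbF ?orbT ?mulr0 ?mulr1 ?addr0 //.
        by case: ifP => [xe|_]; lra.
      by rewrite mulr0 addr0; case: ifP.
    exact: measurable_funM.
  rewrite (splitE _ (mX1 n.+1)) // [mean (psi n)](splitE _ (mX1 n)) // [leRHS]addeAC.
  apply: leeD => //.
  have h01 w : 0 <= h n w <= 1 by rewrite h0 -subr_ge0 h1.
  apply: (le_trans _ (drift (sh n) h01)).
  by rewrite leeDl //; apply: mean_ge0 => w; rewrite !mulr_ge0.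
apply: filterS => w [M HM].
have eta20 : 0 < eta / 2 by rewrite divr_gt0.
have etaU n : 0 <= eta * U n w by rewrite mulr_ge0 // ltW.
have [N HN] := bsum_cvg0 etaU (ex_intro _ M HM) eta20.
exists N => n Nn hn; rewrite ltNge; apply/negP => hx.
by have := HN n Nn; have := eta0; rewrite /U hn hx /= mulr1; lra.
Qed.

End Upcrossing.

Theorem robbins_siegmund : {ae P, forall w, ~ bsum (c ^~ w) ->
  forall eta, 0 < eta -> exists N, forall n, (N <= n)%N -> X n w <= eta}.
Proof.
have ev : {ae P, forall w, forall k : nat, exists N, forall n, (N <= n)%N ->
    low k.+1%:R^-1 n w -> X n.+1 w < 2 * k.+1%:R^-1}.
  by apply: ae_foralln => k; apply: rs_finite_crossings; rewrite invr_gt0.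
apply: filterS2 rs_drift_summable ev => w sX ev nc eta eta0.
have eta20 : 0 < eta / 2 by rewrite divr_gt0.
have [k] := ltr_add_invr eta20; rewrite add0r => hk.
have k0 : 0 < k.+1%:R^-1 :> R by rewrite invr_gt0.
have [N HN] := ev k.
have [m Nm Xm] : exists2 m, (N <= m)%N & X m w <= k.+1%:R^-1.
  apply: contrapT => H; apply: nc.
  apply: (@bsum_le_eventually _ _ (fun n => k.+1%:R * (c n w * X n w)) N).
  - by move=> n; rewrite !mulr_ge0.
  - move=> n Nn; rewrite mulrCA -{1}(mulr1 (c n w)); apply: ler_wpM2l => //.
    rewrite -ler_pdivrMl // mulr1 leNgt; apply/negP => xn; apply: H.
    by exists n => //; exact: ltW.
  - exact: (@bsum_le _ _ (fun n => c n w * X n w) k.+1%:R).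
have lo n : (m <= n)%N -> low k.+1%:R^-1 n w.
  elim: n => [|n IH].
    by rewrite leqn0 => /eqP <- ; case: (m) Xm => //= ? ->.
  rewrite leq_eqVlt => /orP[/eqP <-|mn]; first by case: (m) Xm => //= ? ->.
  by rewrite /= (IH mn) HN ?orbT //; [exact: (leq_trans Nm mn)|exact: IH].
exists m => n mn; move: hk (low_lt k0 (lo n mn)); move: (_^-1) => r; lra.
Qed.

End RobbinsSiegmund.
End AlmostSureSummability.

(** * Elementary inequalities *)

Section Elementary.
Context (R : realType).
Implicit Types a b u v x y r : R.

(* The equation a^2 - b^2 = a^2 b^2 v^2 characterizes b = 1/sqrt(S + v^2) for
   a = 1/sqrt(S): it says that 1/b^2 - 1/a^2 = v^2. *)

Lemma gap_lower a b v : 0 < b -> b <= a -> a ^+ 2 - b ^+ 2 = a ^+ 2 * b ^+ 2 * v ^+ 2 ->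
  a * b ^+ 2 * v ^+ 2 <= 2 * (a - b).
Proof.
move=> b0 ba E; have a0 : 0 < a by exact: lt_le_trans ba.
rewrite -(ler_pM2l a0); nra.
Qed.

Lemma gap_upper a b v : 0 < b -> b <= a -> a ^+ 2 - b ^+ 2 = a ^+ 2 * b ^+ 2 * v ^+ 2 ->
  a - b <= a ^+ 3 * v ^+ 2.
Proof.
move=> b0 ba E; have a0 : 0 < a by exact: lt_le_trans ba.
have v0 := sqr_ge0 v.
have H : a - b <= a * b ^+ 2 * v ^+ 2 by rewrite -(ler_pM2l a0); nra.
apply: (le_trans H); rewrite exprS ler_wpM2r // ler_pM2l // ler_sqr ?nnegrE; lra.
Qed.

(** If a v <= 1, then a^2 = b^2 (1 + a^2 v^2) <= 2 b^2, so that a and b are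
    comparable. *)
Lemma gap_lower_small a b v : 0 < b -> b <= a -> 0 <= v -> a * v <= 1 ->
  a ^+ 2 - b ^+ 2 = a ^+ 2 * b ^+ 2 * v ^+ 2 -> a ^+ 3 * v ^+ 2 <= 4 * (a - b).
Proof.
move=> b0 ba v0 av E; have a0 : 0 < a by exact: lt_le_trans ba.
have H := gap_lower b0 ba E.
have av0 : 0 <= a * v by rewrite mulr_ge0 // ltW.
have av2 : (a * v) ^+ 2 <= 1 by rewrite expr_le1.
have b20 : 0 < b ^+ 2 by rewrite exprn_gt0.
have K : a ^+ 2 <= 2 * b ^+ 2 by move: E av2; rewrite exprMn; nra.
have K2 : a * v ^+ 2 * a ^+ 2 <= a * v ^+ 2 * (2 * b ^+ 2).
  by apply: ler_wpM2l => //; rewrite mulr_ge0 ?sqr_ge0 // ltW.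
have -> : a ^+ 3 * v ^+ 2 = a * v ^+ 2 * a ^+ 2 by ring.
lra.
Qed.

(** Up to the factor 1/2 this is Bernoulli's inequality t^r <= 1 - r (1 - t) at
    t = b / a.  It converts a bound by a - b into one that telescopes in a^r. *)
Lemma powR_gap a b r : 0 < b -> b <= a -> 0 < r -> r <= 1 ->
  r / 2 * a `^ r * (a - b) <= a * (a `^ r - b `^ r).
Proof.
move=> b0 ba r0 r1; have a0 : 0 < a by exact: lt_le_trans ba.
pose t := b / a; have bE : b = t * a by rewrite /t divfK // gt_eqF.
have t0 : 0 < t by rewrite divr_gt0.
have t1 : t <= 1 by rewrite ler_pdivrMr // mul1r.
have lnt : ln t <= t - 1.
  have := @le_ln1Dx R (t - 1); rewrite (_ : 1 + (t - 1) = t); last by ring.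
  by apply; lra.
have tr : t `^ r * (1 + r * (1 - t)) <= 1.
  rewrite /powR gt_eqF //= -[leRHS](mulfV (lt0r_neq0 (expR_gt0 (r * ln t)))).
  apply: ler_wpM2l; first exact: expR_ge0.
  rewrite -expRN.
  apply: le_trans (expR_ge1Dx _); nra.
have tr0 : 0 <= t `^ r by exact: powR_ge0.
have key : r / 2 * (1 - t) <= 1 - t `^ r.
  have z0 : 0 <= r * (1 - t) by rewrite mulr_ge0 //; lra.
  have z1 : r * (1 - t) <= 1 by rewrite mulr_ile1 //; lra.
  have -> : r / 2 * (1 - t) = r * (1 - t) / 2 by ring.
  move: z0 z1 tr; move: (r * (1 - t)) => z z0 z1 tr.
  rewrite -(@ler_pM2l _ (1 + z)); nra.
have ar : 0 < a `^ r by exact: powR_gt0.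
have -> : b `^ r = t `^ r * a `^ r by rewrite bE powRM // ltW.
rewrite bE.
have -> : r / 2 * a `^ r * (a - t * a) = a * a `^ r * (r / 2 * (1 - t)) by ring.
have -> : a * (a `^ r - t `^ r * a `^ r) = a * a `^ r * (1 - t `^ r) by ring.
by rewrite ler_pM2l // mulr_gt0.
Qed.

(** One step of the energy estimate for V = a g + alpha beta a^2 u^2.  The error
    a (a - b) u v caused by the dependence of the step size on the current
    gradient is split by Young's inequality with weight h = beta u^2 + s: its
    first part is absorbed in mean, since h bounds the conditional mean of v^2, and
    u^2 a (a - b) telescopes up to terms of lower order. *)
Lemma energy_step (L alpha beta s a0 a b u u' v p g g' : R) :
  0 <= L -> 0 <= alpha -> 0 <= beta -> 0 < s ->
  0 < b -> b <= a -> a <= a0 -> a ^+ 2 - b ^+ 2 = a ^+ 2 * b ^+ 2 * v ^+ 2 ->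
  0 <= u -> 0 <= v -> 0 <= u' -> `|p| <= u * v -> 0 <= g' ->
  g' <= g - alpha * b * p + L * alpha ^+ 2 * b ^+ 2 * v ^+ 2 ->
  u' <= u + L * alpha * b * v ->
  b * g' + alpha * beta * (b ^+ 2 * u' ^+ 2) + alpha * (a ^+ 2 * p) <=
  a * g + alpha * beta * (a ^+ 2 * u ^+ 2)
  + alpha / 4 * (a ^+ 2 * u ^+ 2 / (beta * u ^+ 2 + s) * v ^+ 2)
  + alpha / 4 * (a ^+ 2 * u ^+ 2)
  + (2 * L * alpha ^+ 2 + alpha * s * a0 + 2 * a0 * alpha * (2 * beta * L * alpha) ^+ 2
     + 2 * a0 * alpha * beta * (L * alpha) ^+ 2) * (a - b).
Proof.
move=> L0 al0 be0 s0 b0 ba aa0 E u0 v0 u'0 pu g'0 gg uu.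
have a0' : 0 < a by exact: lt_le_trans ba.
pose D := a - b; have D0 : 0 <= D by rewrite subr_ge0.
have H1 : a * b ^+ 2 * v ^+ 2 <= 2 * D := gap_lower b0 ba E.
pose h := beta * u ^+ 2 + s.
have h0 : 0 < h by rewrite /h ltr_wpDl // mulr_ge0 ?sqr_ge0.
(* first-order term *)
have S1 : b * g' <= a * g - alpha * (a * b) * p + L * alpha ^+ 2 * (a * b ^+ 2 * v ^+ 2).
  apply: (@le_trans _ _ (a * g')); first exact: ler_wpM2r.
  apply: (le_trans (ler_wpM2l (ltW a0') gg)); rewrite le_eqVlt; apply/orP; left.
  by apply/eqP; ring.
have S2 : - (alpha * (a * b) * p) <= - (alpha * (a ^+ 2 * p)) + alpha * (a * D * u * v).
  have : alpha * (a * D) * p <= alpha * (a * D) * (u * v).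
    apply: ler_wpM2l; first by rewrite !mulr_ge0 // ltW.
    exact: le_trans (ler_norm p) pu.
  rewrite /D; nra.
have S3 : L * alpha ^+ 2 * (a * b ^+ 2 * v ^+ 2) <= L * alpha ^+ 2 * (2 * D).
  by apply: ler_wpM2l => //; rewrite mulr_ge0 ?sqr_ge0.
have S4 : a * D * u * v <= 4^-1 * (a ^+ 2 * u ^+ 2 / h * v ^+ 2) + h * D ^+ 2.
  rewrite -(ler_pM2r h0).
  have -> : (4^-1 * (a ^+ 2 * u ^+ 2 / h * v ^+ 2) + h * D ^+ 2) * h =
    4^-1 * (a * u * v) ^+ 2 + (h * D) ^+ 2 by field; rewrite gt_eqF.
  have := sqr_ge0 (2^-1 * (a * u * v) - h * D); nra.
have DD : D ^+ 2 <= a * D by rewrite expr2 ler_wpM2r // /D; lra.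
have S5 : h * D ^+ 2 <= s * a0 * D + beta * (a * D * u ^+ 2).
  have u2 := sqr_ge0 u.
  have : h * D ^+ 2 <= h * (a * D) by rewrite ler_pM2l.
  have : s * (a * D) <= s * (a0 * D) by rewrite ler_pM2l // ler_wpM2r.
  rewrite /h; nra.
have S6 : a * D * u ^+ 2 <= a ^+ 2 * u ^+ 2 - b ^+ 2 * u' ^+ 2 + b ^+ 2 * (u' ^+ 2 - u ^+ 2).
  have -> : a ^+ 2 * u ^+ 2 - b ^+ 2 * u' ^+ 2 + b ^+ 2 * (u' ^+ 2 - u ^+ 2)
     = D * (a + b) * u ^+ 2 by rewrite /D; ring.
  apply: ler_wpM2r; [exact: sqr_ge0|]; rewrite mulrC; apply: ler_wpM2l => //; lra.
have S7 : u' ^+ 2 - u ^+ 2 <= 2 * (L * alpha) * b * u * v + (L * alpha) ^+ 2 * b ^+ 2 * v ^+ 2.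
  have : u' ^+ 2 <= (u + L * alpha * b * v) ^+ 2 by rewrite ler_sqr ?nnegrE //; apply: le_trans uu.
  nra.
have b4 : b ^+ 4 * v ^+ 2 <= 2 * a0 * D.
  apply: (@le_trans _ _ (b * (a * b ^+ 2 * v ^+ 2))).
    have -> : b ^+ 4 * v ^+ 2 = b * b ^+ 2 * v ^+ 2 * b by ring.
    have -> : b * (a * b ^+ 2 * v ^+ 2) = b * b ^+ 2 * v ^+ 2 * a by ring.
    by apply: ler_wpM2l => //; rewrite !mulr_ge0 ?sqr_ge0 // ltW.
  apply: (@le_trans _ _ (b * (2 * D))); first by rewrite ler_pM2l.
  rewrite mulrCA -mulrA ler_pM2l // ler_wpM2r //; lra.
have S8 : beta * (b ^+ 2 * (2 * (L * alpha) * b * u * v)) <=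
    4^-1 * (a ^+ 2 * u ^+ 2) + (2 * beta * L * alpha) ^+ 2 * (b ^+ 4 * v ^+ 2).
  have K1 : b ^+ 2 * u ^+ 2 <= a ^+ 2 * u ^+ 2.
    by apply: ler_wpM2r; [exact: sqr_ge0 | rewrite ler_sqr ?nnegrE // ltW].
  have := sqr_ge0 (2^-1 * (b * u) - 2 * beta * L * alpha * b ^+ 2 * v); nra.
have S9 : (2 * beta * L * alpha) ^+ 2 * (b ^+ 4 * v ^+ 2) <=
    (2 * beta * L * alpha) ^+ 2 * (2 * a0 * D) by apply: ler_wpM2l; rewrite ?sqr_ge0.
have S10 : beta * ((L * alpha) ^+ 2 * (b ^+ 4 * v ^+ 2)) <=
    beta * ((L * alpha) ^+ 2 * (2 * a0 * D)).
  by apply: ler_wpM2l => //; apply: ler_wpM2l; rewrite ?sqr_ge0.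
have S11 : beta * (b ^+ 2 * (u' ^+ 2 - u ^+ 2)) <=
   beta * (b ^+ 2 * (2 * (L * alpha) * b * u * v)) + beta * ((L * alpha) ^+ 2 * (b ^+ 4 * v ^+ 2)).
  rewrite -mulrDr; apply: ler_wpM2l => //.
  have -> : b ^+ 2 * (2 * (L * alpha) * b * u * v) + (L * alpha) ^+ 2 * (b ^+ 4 * v ^+ 2)
    = b ^+ 2 * (2 * (L * alpha) * b * u * v + (L * alpha) ^+ 2 * b ^+ 2 * v ^+ 2) by ring.
  by apply: ler_wpM2l; rewrite ?sqr_ge0.
have S12 : beta * (a * D * u ^+ 2) <=
  beta * (a ^+ 2 * u ^+ 2 - b ^+ 2 * u' ^+ 2 + b ^+ 2 * (u' ^+ 2 - u ^+ 2)).
  exact: ler_wpM2l.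
have T : a * D * u * v <= 4^-1 * (a ^+ 2 * u ^+ 2 / h * v ^+ 2) + s * a0 * D
   + beta * (a ^+ 2 * u ^+ 2) - beta * (b ^+ 2 * u' ^+ 2)
   + 4^-1 * (a ^+ 2 * u ^+ 2)
   + (2 * beta * L * alpha) ^+ 2 * (2 * a0 * D) + beta * ((L * alpha) ^+ 2 * (2 * a0 * D)).
  lra.
have := ler_wpM2l al0 T.
rewrite -/h -/D; lra.
Qed.

Lemma fourth_power_le y x :
  (y + x) ^+ 4 <= y ^+ 4 + 4 * y ^+ 3 * x + 8 * y ^+ 2 * x ^+ 2 + 3 * x ^+ 4.
Proof. by have := sqr_ge0 ((y - x) * x); nra. Qed.

Lemma sqrD_le2 x y : (x + y) ^+ 2 <= 2 * (x ^+ 2 + y ^+ 2).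
Proof. by have := sqr_ge0 (x - y); nra. Qed.

Lemma sqrB_le2 x y : (x - y) ^+ 2 <= 2 * (x ^+ 2 + y ^+ 2).
Proof. by have := sqr_ge0 (x + y); nra. Qed.

(** Fourth-moment step of the near average.  Here y^2 exceeds K a by at most Y: the
    part K a of y^2 brings a factor a into the quadratic terms and makes them
    summable, and Y is to be dominated by y^4 / (K a).  The term linear in x - m
    has mean zero; J bounds the fourth power of the truncated noise. *)
Lemma near_step_le a K Y J (delta m u v x x' y : R) :
  0 <= a -> a <= 1 -> 0 <= v -> `|x| <= v -> `|m| <= u -> u <= delta -> 0 <= K -> 0 <= Y ->
  y ^+ 2 <= K * a + Y -> 0 <= J -> (a * v <= 1 -> (a * v) ^+ 4 <= J) ->
  x' = (if a * v <= 1 then x else 0) ->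
  (y + a * (x' - m)) ^+ 4 <=
  4 * y ^+ 3 * a * (x - m) + y ^+ 4 + a ^+ 2 * (2 * y ^+ 4 + 18 * Y) * v ^+ 2
  + 16 * delta ^+ 2 * (a ^+ 2 * Y)
  + (18 * K * (a ^+ 3 * v ^+ 2) + 24 * J + (24 * delta ^+ 2 + 16 * K) * (a ^+ 2 * u ^+ 2)).
Proof.
move=> a0 a1 v0 xv mu ud K0 Y0 yK J0 JH x'E.
have u0 : 0 <= u by apply: le_trans mu.
have d0 : 0 <= delta by exact: le_trans ud.
have x'v : `|x'| <= v by rewrite x'E; case: ifP => _ //; rewrite normr0.
have sqle (p q : R) : `|p| <= q -> p ^+ 2 <= q ^+ 2.
  move=> pq; rewrite -[p ^+ 2]real_normK ?num_real // ler_sqr ?nnegrE //.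
  exact: le_trans pq.
have x2 := sqle _ _ x'v; have m2 := sqle _ _ mu.
have ud2 : u ^+ 2 <= delta ^+ 2 by rewrite ler_sqr ?nnegrE.
have a20 := sqr_ge0 a; have v20 := sqr_ge0 v; have u20 := sqr_ge0 u; have y20 := sqr_ge0 y.
have a2v2 : 0 <= a ^+ 2 * v ^+ 2 by rewrite mulr_ge0.
have a2u2 : 0 <= a ^+ 2 * u ^+ 2 by rewrite mulr_ge0.
(* the truncation error of the linear term *)
have cut : - (4 * y ^+ 3 * a * (x - x')) <= (2 * y ^+ 2 + 2 * y ^+ 4) * (a ^+ 2 * v ^+ 2).
  have [av|av] := leP (a * v) 1.
    rewrite x'E av subrr mulr0 oppr0 mulr_ge0 // addr_ge0 // mulr_ge0 //.
    by rewrite exprn_even_ge0.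
  rewrite x'E (leNgt (a * v)) av /= subr0.
  apply: (le_trans (ler_norm _)).
  rewrite normrN (_ : 4 * y ^+ 3 * a * x = 4 * y ^+ 3 * (a * x)); last by ring.
  rewrite normrM normrM ger0_norm //.
  have ax : `|a * x| <= a ^+ 2 * v ^+ 2.
    rewrite normrM (ger0_norm a0); apply: (@le_trans _ _ (a * v)); first exact: ler_wpM2l.
    by rewrite -exprMn expr2; apply: ler_peMl; [rewrite mulr_ge0 | exact: ltW].
  have y3 : 4 * `|y ^+ 3| <= 2 * y ^+ 2 + 2 * y ^+ 4.
    rewrite normrX; have -> : y ^+ 2 = `|y| ^+ 2 by rewrite real_normK ?num_real.
    have -> : y ^+ 4 = `|y| ^+ 4.
      by rewrite -[4%N]/(2 * 2)%N !exprM real_normK ?num_real.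
    by have := sqr_ge0 (`|y| * (`|y| - 1)); nra.
  by apply: ler_pM => //; rewrite mulr_ge0.
have xi2 : (a * (x' - m)) ^+ 2 <= 2 * (a ^+ 2 * v ^+ 2 + a ^+ 2 * u ^+ 2).
  rewrite exprMn; apply: (le_trans (ler_wpM2l a20 (sqrB_le2 x' m))).
  have := ler_wpM2l a20 (lerD x2 m2); lra.
have xi4 : (a * (x' - m)) ^+ 4 <= 8 * J + 8 * (delta ^+ 2 * (a ^+ 2 * u ^+ 2)).
  have H : (a * (x' - m)) ^+ 4 <= 8 * ((a * x') ^+ 4 + (a * m) ^+ 4).
    rewrite mulrBr; move: (a * x') (a * m) => p q.
    have H1 := sqrB_le2 p q; have H2 := sqrD_le2 (p ^+ 2) (q ^+ 2).
    have H3 : ((p - q) ^+ 2) ^+ 2 <= (2 * (p ^+ 2 + q ^+ 2)) ^+ 2.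
      by rewrite ler_sqr ?nnegrE ?sqr_ge0 // mulr_ge0 // addr_ge0 ?sqr_ge0.
    nra.
  have Hx : (a * x') ^+ 4 <= J.
    have [av|av] := leP (a * v) 1; last first.
      by rewrite x'E (leNgt (a * v)) av /= mulr0 expr0n.
    apply: le_trans (JH av); rewrite -[4%N]/(2 * 2)%N !exprM ler_sqr ?nnegrE ?sqr_ge0 //.
    by rewrite !exprMn ler_wpM2l.
  have Hm : (a * m) ^+ 4 <= delta ^+ 2 * (a ^+ 2 * u ^+ 2).
    have -> : (a * m) ^+ 4 = (a ^+ 2 * m ^+ 2) * (a ^+ 2 * m ^+ 2) by ring.
    have m20 := sqr_ge0 m.
    apply: ler_pM; [exact: mulr_ge0|exact: mulr_ge0| |].
      apply: (@le_trans _ _ (1 * m ^+ 2)); last by rewrite mul1r; exact: (le_trans m2 ud2).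
      by rewrite ler_wpM2r ?sqr_ge0 // exprn_ile1.
    by rewrite ler_wpM2l.
  lra.
have F4 := fourth_power_le y (a * (x' - m)).
have P1 : 8 * y ^+ 2 * (a * (x' - m)) ^+ 2 <=
    16 * (y ^+ 2 * (a ^+ 2 * v ^+ 2)) + 16 * (y ^+ 2 * (a ^+ 2 * u ^+ 2)).
  have := ler_wpM2l y20 xi2; lra.
have P2 : y ^+ 2 * (a ^+ 2 * v ^+ 2) <= K * (a ^+ 3 * v ^+ 2) + a ^+ 2 * Y * v ^+ 2.
  by have := ler_wpM2r a2v2 yK; lra.
have P3 : y ^+ 2 * (a ^+ 2 * u ^+ 2) <= K * (a ^+ 2 * u ^+ 2) + delta ^+ 2 * (a ^+ 2 * Y).
  have H1 := ler_wpM2r a2u2 yK.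
  have H2 : K * a * (a ^+ 2 * u ^+ 2) <= K * (a ^+ 2 * u ^+ 2).
    by apply: ler_wpM2r => //; rewrite ler_piMr.
  have H3 : Y * (a ^+ 2 * u ^+ 2) <= Y * (a ^+ 2 * delta ^+ 2).
    by apply: ler_wpM2l => //; apply: ler_wpM2l.
  lra.
lra.
Qed.

End Elementary.

(** * Averaging of centred noise *)

Section Centered.
Context (R : realType) (disp : measure_display) (Omega : measurableType disp)
  (P : probability Omega R).
Implicit Types f g N : Omega -> R.

Lemma measurable_inv_pos (d' : measure_display) (T : measurableType d') (f : T -> R) :
  (forall w, 0 < f w) -> measurable_fun setT f ->
  measurable_fun setT (fun w => (f w)^-1).
Proof.
move=> f0 mf; under eq_fun do rewrite -powR_inv1 ?ltW //.
exact: (measurableT_comp (@measurable_powR R (-1)) mf).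
Qed.

Lemma measurable_natr_bool (d' : measure_display) (T : measurableType d') (b : T -> bool) :
  measurable_fun setT b -> measurable_fun setT (fun w => (b w)%:R : R).
Proof.
move=> mb; rewrite (_ : (fun w => _) = fun w => if b w then 1 else 0).
  exact: measurable_fun_ifT.
by apply/funext => w; case: (b w).
Qed.

Lemma integrable_dom f g : measurable_fun setT f -> measurable_fun setT g ->
  (mean P g < +oo)%E -> (forall w, `|f w| <= g w) ->
  P.-integrable setT (fun w => (f w)%:E).
Proof.
move=> mf mg; rewrite meanE => gfin fg.
have g0 w : 0 <= g w by apply: le_trans (fg w).
apply/integrableP; split; first exact/measurable_EFinP.
apply: le_lt_trans gfin; apply: ge0_le_integral => //.
- by apply/measurable_EFinP; exact: measurableT_comp.
- exact/measurable_EFinP.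
- by move=> w _; rewrite abse_EFin lee_fin.
Qed.

Lemma mean_sum (f : nat -> Omega -> R) n : (forall i, measurable_fun setT (f i)) ->
  (forall i w, 0 <= f i w) -> (\sum_(i < n) mean P (f i))%E = mean P (fun w => \sum_(i < n) f i w).
Proof.
move=> mf f0; elim: n => [|n IH].
  rewrite big_ord0 (eq_mean P (g := fun=> 0)) ?mean_cst // => w.
  by rewrite big_ord0.
rewrite big_ord_recr /= IH -(meanD P _ (mf n) _ (f0 n)).
- by apply: eq_mean => w; rewrite big_ord_recr.
- exact: measurable_sum.
- by move=> w; apply: sumr_ge0.
Qed.

Definition centered N :=
  P.-integrable setT (fun w => (N w)%:E) /\ (\int[P]_w (N w)%:E = 0)%E.

Lemma centeredB f g : P.-integrable setT (fun w => (f w)%:E) ->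
  P.-integrable setT (fun w => (g w)%:E) ->
  (\int[P]_w (f w)%:E = \int[P]_w (g w)%:E)%E -> centered (fun w => f w - g w).
Proof.
move=> intf intg E; split; first exact: (integrableB measurableT intf intg).
under eq_integral do rewrite EFinB.
rewrite (integralB measurableT intf intg) E subee //.
exact: integrable_fin_num.
Qed.

Lemma centered_sum (I : Type) (r : seq I) (N : I -> Omega -> R) :
  (forall i, centered (N i)) -> centered (fun w => \sum_(i <- r) N i w).
Proof.
move=> cN; split.
  under eq_fun do rewrite -sumEFin.
  by apply: (integrable_sum measurableT) => i _; exact: (cN i).1.
under eq_integral do rewrite -sumEFin.
rewrite integral_sum //; last by move=> i; exact: (cN i).1.
by rewrite big1 // => i _; exact: (cN i).2.
Qed.

(** The form in which inequalities along paths are integrated: N collects the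
    martingale increments, while f and g may have infinite mean. *)
Lemma mean_le_centered f g N : measurable_fun setT f -> measurable_fun setT g ->
  (forall w, 0 <= f w) -> (forall w, 0 <= g w) -> centered N ->
  (forall w, f w <= N w + g w) -> (mean P f <= mean P g)%E.
Proof.
move=> mf mg f0 g0 [iN N0] fg.
have [->|gfin] := eqVneq (mean P g) +oo%E; first exact: leey.
have ig : P.-integrable setT (fun w => (g w)%:E).
  apply: (integrable_dom mg mg); first by rewrite ltey.
  by move=> w; rewrite ger0_norm.
have mN : measurable_fun setT N by apply/measurable_EFinP/(measurable_int _ iN).
apply: (@le_trans _ _ (mean P (fun w => N w + g w))).
  by apply: mean_le => //; exact: measurable_funD.
rewrite [leLHS]meanE; under eq_integral do rewrite EFinD.
by rewrite (integralD measurableT iN ig) N0 add0e meanE.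
Qed.

End Centered.

(** Moving average of the noise xi, whose memory decays at the rate of the clock c. *)
Fixpoint forget (R : realType) (T : Type) (c xi : nat -> T -> R) (n : nat) (w : T) : R :=
  if n is m.+1 then (1 - c m w) * forget c xi m w + xi m w else 0.

Section Forget.
Context (R : realType) (T : Type) (c xi : nat -> T -> R) (w : T).

Lemma sum_forget m k : (m <= k)%N -> \sum_(m <= i < k) xi i w =
  forget c xi k w - forget c xi m w + \sum_(m <= i < k) c i w * forget c xi i w.
Proof.
elim: k => [|k IH].
  by rewrite leqn0 => /eqP ->; rewrite !big_geq // subrr addr0.
rewrite leq_eqVlt => /orP[/eqP ->|mk]; first by rewrite !big_geq // subrr addr0.
have {}mk : (m <= k)%N by [].
by rewrite !(big_nat_recr k m) //= (IH mk); ring.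
Qed.

(** By [sum_forget] the window sum is an increment of the average, at most 2 e, plus
    the accumulated decay, at most e for each unit of clock. *)
Lemma window_forget (e tau : R) N : 0 <= e -> (forall i, 0 <= c i w) ->
  (forall i, (N <= i)%N -> `|forget c xi i w| <= e) ->
  forall m k, (N <= m)%N -> (m <= k)%N -> \sum_(m <= i < k) c i w <= tau ->
  `|\sum_(m <= i < k) xi i w| <= (2 + tau) * e.
Proof.
move=> e0 c0 He m k Nm mk ctau; rewrite sum_forget //.
apply: (le_trans (ler_normD _ _)).
have H1 : `|forget c xi k w - forget c xi m w| <= 2 * e.
  apply: (le_trans (ler_normB _ _)); have := He k (leq_trans Nm mk); have := He m Nm; lra.
have H2 : `|\sum_(m <= i < k) c i w * forget c xi i w| <= tau * e.
  apply: (le_trans (ler_norm_sum _ _ _)).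
  apply: (@le_trans _ _ ((\sum_(m <= i < k) c i w) * e)).
    rewrite mulr_suml; apply: ler_sum_nat => i /andP[mi _].
    by rewrite normrM ger0_norm // ler_wpM2l // He // (leq_trans Nm).
  exact: ler_wpM2r.
lra.
Qed.

End Forget.

(** * Summability along an adaptive step size *)

Ltac mfun_leaf := first
  [ exact: measurable_cst
  | match goal with H : sub_measurable _ _ |- _ => exact: H end
  | match goal with H : measurable_fun _ _ |- _ => exact: H end
  | match goal with H : forall n, sub_measurable _ _ |- _ => exact: (@H _) end
  | match goal with H : forall n, measurable_fun _ _ |- _ => exact: (@H _) end ].

Ltac mfun := rewrite ?/sub_measurable; lazymatch goal with
  | |- measurable_fun _ (fun w => (_ - _)%R) => apply: measurable_funB; mfun
  | |- measurable_fun _ (fun w => (_ + _)%R) => apply: measurable_funD; mfun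
  | |- measurable_fun _ (fun w => (_ * _)%R) => apply: measurable_funM; mfun
  | |- measurable_fun _ (fun w => (_ ^+ _)%R) => apply: measurable_funX; mfun
  | |- _ => mfun_leaf
  end.

Ltac nonneg := first [assumption | lazymatch goal with
  | |- is_true (0 <= _ + _) => apply: addr_ge0; nonneg
  | |- is_true (0 <= _ * _) => apply: mulr_ge0; nonneg
  | |- is_true (0 <= _ ^+ 2) => exact: sqr_ge0
  | |- _ => solve [done | exact: ler0n | exact: ltW | exact: exprn_ge0 | exact: exprn_even_ge0]
  end].

(* Comparing real powers up to unfolding is costly and never needed. *)
#[local] Opaque powR.

(** The algorithm reduced to scalars: u and v stand for the norms of the gradient
    and of the stochastic gradient.  At time n the value u n is known and v n is
    not, so that step n is predictable and step n.+1 is the step actually taken. *)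
Section AdaptiveSteps.
Context (R : realType) (disp : measure_display) (Omega : measurableType disp)
  (P : probability Omega R).
Variables (F : nat -> set (set Omega)) (S u v : nat -> Omega -> R).
Variables (S0 beta s delta kappa r eta : R).
Local Notation E := (mean P).

Hypothesis filt : filtration F.
Hypothesis S_init : forall w, S 0%N w = S0.
Hypothesis S0_gt0 : 0 < S0.
Hypothesis S_rec : forall n w, S n.+1 w = S n w + v n w ^+ 2.
Hypothesis u0 : forall n w, 0 <= u n w.
Hypothesis v0 : forall n w, 0 <= v n w.
Hypothesis mS : forall n, sub_measurable (F n) (S n).
Hypothesis mu : forall n, sub_measurable (F n) (u n).
Hypothesis mv : forall n, sub_measurable (F n.+1) (v n).
Hypothesis beta0 : 0 <= beta.
Hypothesis s0 : 0 < s.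
Hypothesis v2_fin : forall n, (E (fun w => v n w ^+ 2)%R < +oo)%E.
Hypothesis moment2 : forall n (Z : Omega -> R), sub_measurable (F n) Z ->
  (forall w, 0 <= Z w) ->
  (E (fun w => Z w * v n w ^+ 2)%R <= E (fun w => Z w * (beta * u n w ^+ 2 + s))%R)%E.

Definition step n w : R := (Num.sqrt (S n w))^-1.
Local Notation a := step.

Let smW n (d' : measure_display) (U : measurableType d') (f : Omega -> U) :
  sub_measurable (F n) f -> measurable_fun setT f.
Proof. by move=> mf; have [sF Fm _] := filt; exact: (sub_measurableW (sF n) (@Fm n)). Qed.

Let up n (d' : measure_display) (U : measurableType d') (f : Omega -> U) :
  sub_measurable (F n) f -> sub_measurable (F n.+1) f.
Proof.
move=> mf; have [sF _ Fle] := filt.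
by apply: (sub_measurable_le (sF n)) mf => //; exact: Fle.
Qed.

Lemma S_gt0 n w : 0 < S n w.
Proof. by elim: n => [|n IH]; rewrite ?S_init ?S_rec // ltr_wpDr // sqr_ge0. Qed.

Lemma step_gt0 n w : 0 < a n w.
Proof. by rewrite /step invr_gt0 sqrtr_gt0 S_gt0. Qed.

Let a0 n w : 0 <= a n w. Proof. exact/ltW/step_gt0. Qed.

Lemma step_sqr n w : a n w ^+ 2 = (S n w)^-1.
Proof. by rewrite /step exprVn sqr_sqrtr // ltW // S_gt0. Qed.

Lemma step_anti n w : a n.+1 w <= a n w.
Proof.
rewrite /step lef_pV2 ?posrE ?sqrtr_gt0 ?S_gt0 // ler_wsqrtr // S_rec.
by rewrite lerDl sqr_ge0.
Qed.

Lemma step_gap n w :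
  a n w ^+ 2 - a n.+1 w ^+ 2 = a n w ^+ 2 * a n.+1 w ^+ 2 * v n w ^+ 2.
Proof.
have Sn := S_gt0 n w; have := S_gt0 n.+1 w.
rewrite !step_sqr S_rec => Sn1.
by field; rewrite !gt_eqF.
Qed.

Definition step0 : R := (Num.sqrt S0)^-1.

Lemma step_init w : a 0%N w = step0. Proof. by rewrite /step S_init. Qed.

Lemma step_le0 n w : a n w <= step0.
Proof.
by elim: n => [|n IH]; [rewrite step_init | exact: le_trans (step_anti n w) IH].
Qed.

Lemma measurable_step n : sub_measurable (F n) (a n).
Proof.
apply: measurable_inv_pos => [w|]; first by rewrite sqrtr_gt0 S_gt0.
have -> : (fun w => Num.sqrt (S n w)) = (fun w => S n w `^ 2^-1).
  by apply/funext => w; rewrite powR12_sqrt // ltW // S_gt0.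
exact: (measurableT_comp (@measurable_powR R 2^-1) (@mS n)).
Qed.
Let ma := measurable_step.
Let ta n : measurable_fun setT (a n). Proof. exact: (@smW n). Qed.
Let tu n : measurable_fun setT (u n). Proof. exact: (@smW n). Qed.
Let tv n : measurable_fun setT (v n). Proof. exact: (@smW n.+1). Qed.

Lemma gap_summable : bsume (fun n => E (fun w => a n w - a n.+1 w)).
Proof.
apply: (@bsume_telescope0 _ (fun n => E (a n))).
- by move=> n; exact: mean_ge0.
- by rewrite (eq_mean P step_init) mean_cst ltry.
- have q0 n w : 0 <= a n w - a n.+1 w by rewrite subr_ge0 step_anti.
  have mq n : measurable_fun setT (fun w => a n w - a n.+1 w) by mfun.
  move=> n; rewrite -(meanD P (@ta n.+1) (@mq n) (a0 n.+1) (q0 n)).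
  by rewrite (eq_mean P (g := a n)) // => w; rewrite addrC subrK.
Qed.

(** Summing the energy inequality along a path before taking expectations leaves
    only step sizes, gradients and noise, and no function value but the first.  The
    gradient terms on the right amount in mean to half of the left-hand side, which
    is finite because u is bounded at each time. *)
Section Energy.
Variables (g p : nat -> Omega -> R) (L alpha g1 u1 : R).
Hypothesis L0 : 0 <= L.
Hypothesis alpha0 : 0 < alpha.
Hypothesis g_ge0 : forall n w, 0 <= g n w.
Hypothesis g_init : forall w, g 0%N w = g1.
Hypothesis u_init : forall w, u 0%N w = u1.
Hypothesis p_le : forall n w, `|p n w| <= u n w * v n w.
Hypothesis g_descent : forall n w, g n.+1 w <=
  g n w - alpha * a n.+1 w * p n w + L * alpha ^+ 2 * a n.+1 w ^+ 2 * v n w ^+ 2.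
Hypothesis u_growth : forall n w, u n.+1 w <= u n w + L * alpha * a n.+1 w * v n w.
Hypothesis u_bd : forall n, exists U, forall w, u n w <= U.
Hypothesis p_centered : forall n, centered P (fun w => a n w ^+ 2 * (u n w ^+ 2 - p n w)).

Lemma energy_summable : bsume (fun n => E (fun w => a n w ^+ 2 * u n w ^+ 2)%R).
Proof.
pose C := 2 * L * alpha ^+ 2 + alpha * s * step0 + 2 * step0 * alpha * (2 * beta * L * alpha) ^+ 2
     + 2 * step0 * alpha * beta * (L * alpha) ^+ 2.
pose q n w := a n w ^+ 2 * u n w ^+ 2.
pose W n w := q n w / (beta * u n w ^+ 2 + s).
pose V n w := a n w * g n w + alpha * beta * q n w.
pose V0 := step0 * g1 + alpha * beta * (step0 ^+ 2 * u1 ^+ 2).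
have al0 := ltW alpha0; have s0' := ltW s0.
have h0 n w : 0 < beta * u n w ^+ 2 + s by rewrite ltr_wpDl // mulr_ge0 ?sqr_ge0.
have q0 n w : 0 <= q n w by rewrite /q; nonneg.
have W0 n w : 0 <= W n w by rewrite /W divr_ge0 // ltW.
have V_ge0 n w : 0 <= V n w by rewrite /V addr_ge0 // !mulr_ge0.
have D0 n w : 0 <= a n w - a n.+1 w by rewrite subr_ge0 step_anti.
have step00 : 0 <= step0 by rewrite invr_ge0 sqrtr_ge0.
have C0 : 0 <= C by rewrite /C; nonneg.
have V00 : 0 <= V0.
  have := V_ge0 0%N point; rewrite /V /q /V0 g_init u_init step_init.
  by rewrite mulrA.
have main n w : V n w + alpha * \sum_(i < n) a i w ^+ 2 * p i w <=
    V0 + \sum_(i < n) (alpha / 4 * (W i w * v i w ^+ 2) + alpha / 4 * q i w)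
    + C * (step0 - a n w).
  elim: n => [|n IH].
    by rewrite !big_ord0 /V /q /V0 g_init u_init step_init subrr !mulr0 !addr0.
  have := energy_step L0 al0 beta0 s0 (step_gt0 n.+1 w) (step_anti n w) (step_le0 n w)
    (step_gap n w) (u0 n w) (v0 n w) (u0 n.+1 w) (p_le n w) (g_ge0 n.+1 w)
    (g_descent n w) (u_growth n w).
  rewrite !big_ord_recr /=; move: IH; rewrite /V /W /q -/C; lra.
have path n w : \sum_(i < n) q i w <=
    \sum_(i < n) a i w ^+ 2 * (u i w ^+ 2 - p i w) +
    ((V0 + C * step0) / alpha + \sum_(i < n) (4^-1 * (W i w * v i w ^+ 2) + 4^-1 * q i w)).
  have H : alpha * \sum_(i < n) a i w ^+ 2 * p i w <= V0 + C * step0 +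
      alpha * \sum_(i < n) (4^-1 * (W i w * v i w ^+ 2) + 4^-1 * q i w).
    have := main n w; have := V_ge0 n w; have := mulr_ge0 C0 (a0 n w).
    have -> : \sum_(i < n) (alpha / 4 * (W i w * v i w ^+ 2) + alpha / 4 * q i w) =
      alpha * \sum_(i < n) (4^-1 * (W i w * v i w ^+ 2) + 4^-1 * q i w).
      by rewrite mulr_sumr; apply: eq_bigr => i _; ring.
    lra.
  have -> : \sum_(i < n) a i w ^+ 2 * (u i w ^+ 2 - p i w) =
      \sum_(i < n) q i w - \sum_(i < n) a i w ^+ 2 * p i w.
    by rewrite -sumrB; apply: eq_bigr => i _; rewrite /q mulrBr.
  rewrite -(ler_pM2l alpha0).
  have -> : alpha * (\sum_(i < n) q i w - \sum_(i < n) a i w ^+ 2 * p i w +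
     ((V0 + C * step0) / alpha + \sum_(i < n) (4^-1 * (W i w * v i w ^+ 2) + 4^-1 * q i w)))
    = alpha * \sum_(i < n) q i w - alpha * \sum_(i < n) a i w ^+ 2 * p i w +
     (V0 + C * step0 + alpha * \sum_(i < n) (4^-1 * (W i w * v i w ^+ 2) + 4^-1 * q i w)).
    by field; rewrite gt_eqF.
  lra.
have mq n : sub_measurable (F n) (q n) by rewrite /q; mfun.
have tq n : measurable_fun setT (q n) by exact: (@smW n).
have mW n : sub_measurable (F n) (W n).
  rewrite /W; apply: measurable_funM; first exact: mq.
  by apply: measurable_inv_pos => //; mfun.
have tW n : measurable_fun setT (W n) by exact: (@smW n).
pose f i w := 4^-1 * (W i w * v i w ^+ 2) + 4^-1 * q i w.
have tf i : measurable_fun setT (f i) by rewrite /f; mfun.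
have i4 : 0 <= 4^-1 :> R by rewrite invr_ge0.
have f0 i w : 0 <= f i w by rewrite /f; nonneg.
have K0 : 0 <= (V0 + C * step0) / alpha by rewrite divr_ge0 // addr_ge0 // mulr_ge0.
have Ef i : (E (f i) <= (2^-1)%:E * E (q i))%E.
  have Wv0 w : 0 <= W i w * v i w ^+ 2 by nonneg.
  have tWv : measurable_fun setT (fun w => W i w * v i w ^+ 2) by mfun.
  rewrite /f meanD; [|by mfun|by mfun|by move=> w; nonneg|by move=> w; nonneg].
  rewrite !meanZ //.
  have -> : 2^-1 = 4^-1 + 4^-1 :> R by lra.
  rewrite EFinD ge0_muleDl ?lee_fin //.
  apply: leeD => //; apply: lee_wpmul2l; first by rewrite lee_fin.
  (* the weight of W cancels the variance bound *)
  apply: (le_trans (moment2 (mW i) (W0 i))).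
  rewrite (eq_mean P (g := q i)) // => w.
  by rewrite /W divfK // gt_eqF.
have qfin i : E (q i) \is a fin_num.
  rewrite ge0_fin_numE; last exact: mean_ge0.
  have [U HU] := u_bd i.
  apply: (@le_lt_trans _ _ (E (fun=> step0 ^+ 2 * U ^+ 2))); last by rewrite mean_cst ltry.
  apply: mean_le => // w; rewrite /q; apply: ler_pM; rewrite ?sqr_ge0 //.
    by rewrite ler_sqr ?nnegrE // step_le0.
  by rewrite ler_sqr ?nnegrE //; exact: le_trans (HU w).
exists (2 * ((V0 + C * step0) / alpha)) => n.
have sf0 w : 0 <= \sum_(i < n) f i w by apply: sumr_ge0.
have tsf : measurable_fun setT (fun w => \sum_(i < n) f i w) by exact: measurable_sum.
have tg : measurable_fun setT (fun w => (V0 + C * step0) / alpha + \sum_(i < n) f i w) by mfun.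
have g0 w : 0 <= (V0 + C * step0) / alpha + \sum_(i < n) f i w by exact: addr_ge0.
have tsq : measurable_fun setT (fun w => \sum_(i < n) q i w) by exact: measurable_sum.
have sq0 w : 0 <= \sum_(i < n) q i w by apply: sumr_ge0.
have cN := centered_sum (index_enum 'I_n) (fun i : 'I_n => p_centered i).
have := mean_le_centered tsq tg sq0 g0 cN (path n).
rewrite (meanD P (measurable_cst _) tsf (fun=> K0) sf0) mean_cst.
rewrite -(mean_sum P n tq q0) -(mean_sum P n tf f0).
have : (\sum_(i < n) E (f i) <= (2^-1)%:E * \sum_(i < n) E (q i))%E.
  rewrite ge0_sume_distrr; last by move=> i _; exact: mean_ge0.
  by apply: lee_sum => i _; exact: Ef.
have : (\sum_(i < n) E (q i))%E \is a fin_num by apply/sum_fin_numP => i _ _; exact: qfin.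
move: (\sum_(i < n) E (q i))%E (\sum_(i < n) E (f i))%E => x y.
case: x y => [x| |] [y| |] //= _; rewrite -?EFinM -?EFinD ?lee_fin //; lra.
Qed.

End Energy.

Let one_powR : 1 `^ r = 1. Proof. by rewrite powR1. Qed.

Let powstep_anti n w : 0 <= r -> a n.+1 w `^ r <= a n w `^ r.
Proof. by move=> r0; apply: ge0_ler_powR; rewrite ?nnegrE ?step_anti. Qed.

Let mpow n : sub_measurable (F n) (fun w => a n w `^ r).
Proof. exact: (measurableT_comp (@measurable_powR R r) (@ma n)). Qed.
Let tpow n : measurable_fun setT (fun w => a n w `^ r). Proof. exact: (@smW n). Qed.
Let tvpow n : measurable_fun setT (fun w => v n w `^ r).
Proof. exact: (measurableT_comp (@measurable_powR R r) (@tv n)). Qed.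

Lemma powgap_summable : 0 <= r ->
  bsume (fun n => E (fun w => a n w `^ r - a n.+1 w `^ r)).
Proof.
move=> r0; apply: (@bsume_telescope0 _ (fun n => E (fun w => a n w `^ r))).
- by move=> n; apply: mean_ge0 => w; exact: powR_ge0.
- have H w : a 0%N w `^ r = step0 `^ r by rewrite step_init.
  by rewrite (eq_mean P H) mean_cst ltry.
- have p0 n w : 0 <= a n w `^ r by exact: powR_ge0.
  have q0 n w : 0 <= a n w `^ r - a n.+1 w `^ r by rewrite subr_ge0 powstep_anti.
  have mq n : measurable_fun setT (fun w => a n w `^ r - a n.+1 w `^ r) by mfun.
  move=> n; rewrite -(meanD P (@tpow n.+1) (@mq n) (p0 n.+1) (q0 n)).
  by rewrite (eq_mean P (g := fun w => a n w `^ r)) // => w; rewrite addrC subrK.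
Qed.

(** The condition a <= eta holds from some time on where S tends to infinity.
    Imposing it in near and in clock makes the estimates on them valid at all times
    and on all paths. *)
Definition flat n w := u n w <= delta.
Definition small n w := a n w <= eta.
Definition near n w : R := (flat n w && small n w)%:R.
Definition far n w : R := (~~ flat n w)%:R.
Definition clock n w : R := (small n w)%:R * a n w.

Let msmall n : sub_measurable (F n) (small n).
Proof. exact: (measurable_fun_ler (@ma n) (measurable_cst _)). Qed.
Let mlowgrad n : sub_measurable (F n) (flat n).
Proof. exact: (measurable_fun_ler (@mu n) (measurable_cst _)). Qed.

Lemma measurable_near n : sub_measurable (F n) (near n).
Proof. apply: measurable_natr_bool; exact: (measurable_and (@mlowgrad n) (@msmall n)). Qed.
Lemma measurable_far n : sub_measurable (F n) (far n).
Proof. apply: measurable_natr_bool; exact: (measurable_neg (@mlowgrad n)). Qed.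
Lemma measurable_clock n : sub_measurable (F n) (clock n).
Proof. by apply: measurable_funM; [apply: measurable_natr_bool; exact: msmall | exact: ma]. Qed.
Let mnear := measurable_near.
Let mfar := measurable_far.
Let mclock := measurable_clock.
Let tnear n : measurable_fun setT (near n). Proof. exact: (@smW n). Qed.
Let tfar n : measurable_fun setT (far n). Proof. exact: (@smW n). Qed.

Lemma near_ge0 n w : 0 <= near n w. Proof. exact: ler0n. Qed.
Lemma far_ge0 n w : 0 <= far n w. Proof. exact: ler0n. Qed.
Lemma clock_ge0 n w : 0 <= clock n w. Proof. by rewrite mulr_ge0 // ler0n. Qed.

Hypothesis delta0 : 0 < delta.
Hypothesis energy : bsume (fun n => E (fun w => a n w ^+ 2 * u n w ^+ 2)%R).

(** Where the gradient is bounded below, the affine variance bound is a multiple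
    of the squared gradient. *)
Lemma far_summable : bsume (fun n => E (fun w => far n w * (a n w ^+ 2 * v n w ^+ 2))).
Proof.
have C0 : 0 <= beta + s / delta ^+ 2 by rewrite addr_ge0 // divr_ge0 ?sqr_ge0 // ltW.
apply: (bsume_le C0) energy; first by move=> n; apply: mean_ge0 => w; rewrite mulr_ge0 ?sqr_ge0.
move=> n; rewrite -meanZ //; [|by mfun|by move=> w; rewrite mulr_ge0 ?sqr_ge0].
rewrite (eq_mean P (g := fun w => (far n w * a n w ^+ 2) * v n w ^+ 2)); last first.
  by move=> w; rewrite mulrA.
apply: (le_trans (moment2 _ _)).
- by mfun.
- by move=> w; rewrite mulr_ge0 ?sqr_ge0 // far_ge0.
apply: mean_le; [by mfun|by mfun| |].
- by move=> w; rewrite !mulr_ge0 ?sqr_ge0 ?far_ge0 // addr_ge0 ?mulr_ge0 ?sqr_ge0 // ltW.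
move=> w; rewrite /far /flat; have [ud|du] := leP (u n w) delta.
  by rewrite /= !mul0r !mulr_ge0 ?sqr_ge0.
rewrite /= mul1r [leRHS]mulrCA; apply: ler_wpM2l; first exact: sqr_ge0.
rewrite mulrDl lerD2l -mulrA; apply: ler_peMr; first exact: ltW.
by rewrite mulrC ler_pdivlMr ?exprn_gt0 // mul1r ler_sqr ?nnegrE // ltW.
Qed.

Hypothesis r_gt0 : 0 < r.
Hypothesis r_le1 : r <= 1.
Hypothesis kappa0 : 0 <= kappa.
Hypothesis moment_local : forall n (Z : Omega -> R), sub_measurable (F n) Z ->
  (forall w, 0 <= Z w) ->
  (E (fun w => Z w * ((flat n w)%:R * (v n w ^+ 2 * v n w `^ r)))%R <=
   E (fun w => kappa * (Z w * ((flat n w)%:R * v n w ^+ 2)))%R)%E.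
Hypothesis eta_gt0 : 0 < eta.
Hypothesis eta_half : eta <= 2^-1.
Hypothesis eta_kappa : kappa * eta `^ r <= 2^-1.

Let near_cases n w : (near n w = 0) \/
  [/\ near n w = 1, flat n w, a n w <= eta & a n w <= 1].
Proof.
rewrite /near /flat /small; case: (leP (u n w) delta) => //= ud; last by left.
case: (leP (a n w) eta) => ae; last by left.
by right; split => //; move: eta_half; lra.
Qed.

Let vv0 n w : 0 <= v n w ^+ 2. Proof. exact: sqr_ge0. Qed.
Let aa0 n w : 0 <= a n w ^+ 2. Proof. exact: sqr_ge0. Qed.
Let uu0 n w : 0 <= u n w ^+ 2. Proof. exact: sqr_ge0. Qed.
Let ap0 n w : 0 <= a n w `^ r. Proof. exact: powR_ge0. Qed.
Let vp0 n w : 0 <= v n w `^ r. Proof. exact: powR_ge0. Qed.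
Hint Resolve step_gt0 vv0 aa0 uu0 ap0 vp0 near_ge0 far_ge0 clock_ge0 : core.

(** The local moment condition makes the truncated second moment dominate: jumps
    with a v > 1 carry at most half of the total, since v^2 <= a^r v^(2+r) there and
    kappa a^r <= 1/2.  The truncated part is bounded by the decrease of a^r, which
    telescopes. *)
Lemma near_summable2 :
  bsume (fun n => E (fun w => near n w * (a n w ^+ 2 * a n w `^ r) * v n w ^+ 2)).
Proof.
have C0 : 0 <= 2 * (8 / r) by rewrite mulr_ge0 // divr_ge0 // ltW.
have [q0 q0'] : (forall n w, 0 <= a n w `^ r - a n.+1 w `^ r) /\
    (forall n, 0 <= E (fun w => a n w `^ r - a n.+1 w `^ r)%R)%E.
  have H n w : 0 <= a n w `^ r - a n.+1 w `^ r by rewrite subr_ge0 powstep_anti // ltW.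
  by split => // n; exact: mean_ge0.
apply: (bsume_le C0 q0') (powgap_summable (ltW r_gt0)) => n.
pose W w := near n w * (a n w ^+ 2 * a n w `^ r).
have W0 w : 0 <= W w by rewrite !mulr_ge0.
have mW : sub_measurable (F n) W by rewrite /W; mfun.
have tW : measurable_fun setT W by exact: (@smW n).
pose T w := (8 / r) * (a n w `^ r - a n.+1 w `^ r).
have T0 w : 0 <= T w by rewrite mulr_ge0 // divr_ge0 // ltW.
have tT : measurable_fun setT T by rewrite /T; mfun.
pose low w : R := (flat n w)%:R.
have tlow : measurable_fun setT low.
  by apply: measurable_natr_bool; apply: (@smW n); exact: mlowgrad.
pose B w := W w * a n w `^ r * (low w * (v n w ^+ 2 * v n w `^ r)).
have tB : measurable_fun setT B by rewrite /B; mfun.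
have B0 w : 0 <= B w by rewrite !mulr_ge0 // ler0n.
have split w : W w * v n w ^+ 2 <= T w + B w.
  rewrite /B /W /low; case: (near_cases n w) => [->|[-> ud _ _]].
    by rewrite !mul0r addr0.
  rewrite ud /= !mul1r; have [av|av] := leP (a n w * v n w) 1.
    rewrite ler_wpDr ?mulr_ge0 //.
    have H1 := gap_lower_small (step_gt0 n.+1 w) (step_anti n w) (v0 n w) av (step_gap n w).
    have H2 := powR_gap (step_gt0 n.+1 w) (step_anti n w) r_gt0 r_le1.
    have H3 := ler_wpM2l (ap0 n w) H1.
    rewrite /T -(ler_pM2l (step_gt0 n w)) -(ler_pM2l (divr_gt0 r_gt0 (ltr0Sn _ 1))).
    rewrite [leRHS](_ : _ = 4 * (a n w * (a n w `^ r - a n.+1 w `^ r))); last first.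
      by field; rewrite gt_eqF.
    apply: le_trans (ler_wpM2l (ler0n _ 4) H2).
    have := ler_wpM2l (ltW (divr_gt0 r_gt0 (ltr0Sn _ 1))) H3; lra.
  rewrite ler_wpDl //.
  have av1 : 1 <= a n w `^ r * v n w `^ r.
    rewrite -powRM // -one_powR; apply: ge0_ler_powR; rewrite ?nnegrE ?mulr_ge0 ?(ltW av) //.
    exact: ltW.
  have -> : a n w ^+ 2 * a n w `^ r * a n w `^ r * (v n w ^+ 2 * v n w `^ r) =
    a n w ^+ 2 * a n w `^ r * v n w ^+ 2 * (a n w `^ r * v n w `^ r) by ring.
  by apply: ler_peMr => //; rewrite !mulr_ge0.
have half : (E B <= (2^-1)%:E * E (fun w => W w * v n w ^+ 2)%R)%E.
  have mWa : sub_measurable (F n) (fun w => W w * a n w `^ r) by mfun.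
  apply: (le_trans (moment_local mWa _)); first by move=> w; rewrite mulr_ge0.
  rewrite -meanZ //; [|by mfun|by move=> w; rewrite mulr_ge0].
  apply: mean_le; [by mfun|by mfun| |].
    by move=> w; rewrite !mulr_ge0 // ler0n.
  move=> w; rewrite /W; case: (near_cases n w) => [->|[-> ud ae _]].
    by rewrite !(mul0r, mulr0).
  rewrite ud /= !mul1r.
  have H : kappa * a n w `^ r <= 2^-1.
    apply: le_trans eta_kappa; apply: ler_wpM2l => //.
    by apply: ge0_ler_powR; rewrite ?nnegrE //; exact: ltW.
  have := ler_wpM2r (mulr_ge0 (mulr_ge0 (aa0 n w) (ap0 n w)) (vv0 n w)) H.
  by apply: le_trans; rewrite le_eqVlt; apply/orP; left; apply/eqP; ring.
have tWv : measurable_fun setT (fun w => W w * v n w ^+ 2) by mfun.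
have Wv0 w : 0 <= W w * v n w ^+ 2 by rewrite mulr_ge0.
have fin : E (fun w => W w * v n w ^+ 2) \is a fin_num.
  rewrite ge0_fin_numE; last exact: mean_ge0.
  apply: le_lt_trans (v2_fin n); apply: mean_le => //; first by mfun.
  move=> w; rewrite /W; case: (near_cases n w) => [->|[-> _ _ a1]].
    by rewrite !mul0r.
  rewrite mul1r -[leRHS]mul1r; apply: ler_wpM2r => //.
  apply: mulr_ile1 => //; first by rewrite exprn_ile1.
  by rewrite -one_powR; apply: ge0_ler_powR; rewrite ?nnegrE //; exact: ltW.
have main : (E (fun w => W w * v n w ^+ 2)%R <=
    E T + (2^-1)%:E * E (fun w => W w * v n w ^+ 2)%R)%E.
  apply: (@le_trans _ _ (E (fun w => T w + B w))); first by apply: mean_le => //; mfun.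
  by rewrite meanD // leeD.
have ET : E T = ((8 / r)%:E * E (fun w => a n w `^ r - a n.+1 w `^ r)%R)%E.
  by rewrite /T meanZ //; [by mfun | rewrite divr_ge0 // ltW].
rewrite EFinM -muleA -ET -/(W _).
move: main fin; move: (E (fun w => W w * v n w ^+ 2)%R) (E T) => x y.
case: x y => [x| |] [y| |] //=; last by rewrite gt0_muley ?leey ?lte_fin.
by rewrite -!EFinM -EFinD !lee_fin => h _; lra.
Qed.

Lemma near_summable3 : bsume (fun n => E (fun w => near n w * a n w ^+ 3 * v n w ^+ 2)).
Proof.
apply: (bsume_le ler01) near_summable2 => n.
  by apply: mean_ge0 => w; rewrite !mulr_ge0.
rewrite mul1e; apply: mean_le; [by mfun|by mfun| |].
  by move=> w; rewrite !mulr_ge0 ?exprn_ge0.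
move=> w; apply: ler_wpM2r => //.
case: (near_cases n w) => [->|[-> _ _ a1]]; first by rewrite !mul0r.
rewrite !mul1r exprSr; apply: ler_wpM2l => //.
by apply: ger1_powR; rewrite ?step_gt0.
Qed.

(** The local moment condition replaces v^2 v^r by kappa v^2.  This series controls
    both the fourth powers of the truncated noise and the noise cut off. *)
Lemma near_summable_jump :
  bsume (fun n => E (fun w => near n w * (a n w ^+ 2 * a n w `^ r) * (v n w ^+ 2 * v n w `^ r))).
Proof.
apply: (bsume_le kappa0) near_summable2 => n.
  by apply: mean_ge0 => w; rewrite !mulr_ge0.
rewrite -meanZ //; [|by mfun|by move=> w; rewrite !mulr_ge0].
have mZ : sub_measurable (F n) (fun w => near n w * (a n w ^+ 2 * a n w `^ r)) by mfun.
have lowE w (x : R) : near n w * (a n w ^+ 2 * a n w `^ r) * ((flat n w)%:R * x) =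
    near n w * (a n w ^+ 2 * a n w `^ r) * x.
  by case: (near_cases n w) => [->|[-> -> _ _]]; rewrite /= ?mul0r ?mul1r.
have := moment_local mZ; rewrite (eq_mean P (fun w => lowE w _)).
rewrite [X in (_ -> (_ <= X)%E) -> _](eq_mean P (fun w => congr1 _ (lowE w _))).
by apply=> w; rewrite !mulr_ge0.
Qed.

(** * The martingale part of the noise *)

Hypothesis eta_C0 : 8 * (beta * delta ^+ 2 + s) * eta <= 1.
Hypothesis u_bd : forall n, exists U, forall w, u n w <= U.

Let clock_le1 n w : clock n w <= 1.
Proof.
rewrite /clock /small; case: (leP (a n w) eta) => [ae|_] /=; last by rewrite mul0r.
by rewrite mul1r; move: eta_half; lra.
Qed.

Let u2_fin n : (E (fun w => u n w ^+ 2)%R < +oo)%E.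
Proof.
have [U HU] := u_bd n.
apply: (@le_lt_trans _ _ (E (fun=> U ^+ 2))); last by rewrite mean_cst ltry.
apply: mean_le => //; first by mfun.
move=> w; rewrite ler_sqr ?nnegrE //; exact: le_trans (HU w).
Qed.

Lemma mean_ltyD (f g : Omega -> R) : measurable_fun setT f -> measurable_fun setT g ->
  (forall w, 0 <= f w) -> (forall w, 0 <= g w) ->
  (E f < +oo)%E -> (E g < +oo)%E -> (E (fun w => f w + g w)%R < +oo)%E.
Proof. by move=> mf mg f0 g0 ff gf; rewrite meanD // lte_add_pinfty. Qed.

Lemma mean_ltyZ (k : R) (f : Omega -> R) : measurable_fun setT f -> 0 <= k ->
  (forall w, 0 <= f w) -> (E f < +oo)%E -> (E (fun w => k * f w)%R < +oo)%E.
Proof. by move=> mf k0 f0 ff; rewrite meanZ // lte_mul_pinfty // lee_fin. Qed.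

Lemma eventually_small w : S n w @[n --> \oo] --> +oo ->
  exists N, forall n, (N <= n)%N -> small n w.
Proof.
move=> /cvgryPge /(_ (eta ^+ 2)^-1) [N _ HN]; exists N => n /HN /= H.
rewrite /small -ler_sqr ?nnegrE //; last exact: ltW.
by rewrite step_sqr -[leRHS]invrK lef_pV2 // posrE ?S_gt0 // invr_gt0 exprn_gt0.
Qed.

(** If the clock had finite mass, the conditional variance of the near terms would
    make the sum of a v^2 over them finite.  Since the far terms are square
    summable, the product of the factors 1 + a^2 v^2 by which S grows would be
    finite as well. *)
Lemma clock_diverges : {ae P, forall w, S n w @[n --> \oo] --> +oo ->
  ~ bsum (clock ^~ w)}.
Proof.
(* The near terms are summed only while the clock has not passed k, so that their
   expectation is finite. *)
pose A n w := \sum_(i < n.+1) a i w.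
have mA n : sub_measurable (F n) (A n).
  have [sF _ Fle] := filt.
  apply: measurable_sum => i.
  by apply: (sub_measurable_le (sF i)) (@ma i) => //; apply: Fle; rewrite -ltnS.
pose low (k n : nat) w : R := ((A n w <= k%:R)%R)%:R.
have mlow k n : sub_measurable (F n) (low k n).
  by apply: measurable_natr_bool; apply: measurable_fun_ler; mfun.
have tlow k n : measurable_fun setT (low k n) by exact: (@smW n).
have low0 k n w : 0 <= low k n w by exact: ler0n.
have lowsum k n w : \sum_(i < n) low k i w * a i w <= k%:R.
  elim: n => [|n IH]; first by rewrite big_ord0 ler0n.
  rewrite big_ord_recr /= {2}/low; case: (leP (A n w) k%:R) => Ak /=; last first.
    by rewrite mul0r addr0.
  apply: le_trans Ak; rewrite mul1r /A big_ord_recr /= lerD2r.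
  apply: ler_sum => i _; rewrite /low; case: (leP (A i w) k%:R) => _ /=.
    by rewrite mul1r.
  by rewrite mul0r.
pose f k n w := low k n w * near n w * a n w * v n w ^+ 2.
have tf k n : measurable_fun setT (f k n).
  by have tl := tlow k; rewrite /f; mfun.
have f0 k n w : 0 <= f k n w by rewrite /f; nonneg.
have C0 : 0 <= beta * delta ^+ 2 + s by rewrite addr_ge0 ?mulr_ge0 ?sqr_ge0 // ltW.
have fsum k : {ae P, forall w, bsum (f k ^~ w)}.
  have tl := tlow k; have ml := mlow k.
  apply: (bsume_ae (tf k) (f0 k)).
  have la0 i w : 0 <= low k i w * a i w by exact: mulr_ge0.
  have tla i : measurable_fun setT (fun w => low k i w * a i w) by mfun.
  apply: (@bsume_le _ _ (fun n => E (fun w => low k n w * a n w)) (beta * delta ^+ 2 + s)) => //.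
  - by move=> n; exact: mean_ge0.
  - move=> n; rewrite -meanZ //.
    have mZ : sub_measurable (F n) (fun w => low k n w * near n w * a n w) by mfun.
    apply: (le_trans (moment2 mZ _)); first by move=> w; nonneg.
    apply: mean_le; [by mfun|by mfun|by move=> w; have := ltW s0 => ?; nonneg|].
    move=> w; case: (near_cases n w) => [->|[-> ud _ _]].
      by rewrite mulr0 !mul0r; apply: mulr_ge0.
    rewrite mulr1 mulrC; apply: ler_wpM2r => //.
    rewrite lerD2r; apply: ler_wpM2l => //.
    by rewrite ler_sqr ?nnegrE // ltW.
  - exists k%:R => n; have := mean_sum P n tla la0 => /= ->.
    rewrite -[leRHS](mean_cst P); apply: mean_le => //; first exact: measurable_sum.
      by move=> w; apply: sumr_ge0.
    by move=> w; exact: lowsum.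
have farsum : {ae P, forall w, bsum (fun n => far n w * (a n w ^+ 2 * v n w ^+ 2))}.
  by apply: bsume_ae far_summable => [?|? ?]; [mfun|nonneg].
apply: filterS2 farsum (ae_foralln fsum) => w fars fs Soo sc.
have [N HN] := eventually_small Soo.
have clockE n : (N <= n)%N -> clock n w = a n w.
  by move=> /HN sn; rewrite /clock sn mul1r.
have [M HM] : bsum (a ^~ w).
  by apply: (bsum_le_eventually (v := clock ^~ w) (N := N)) => // n Nn; rewrite clockE.
have [k Mk] : exists k : nat, M <= k%:R.
  exists (Num.bound `|M|); apply: (le_trans (ler_norm M)).
  by apply: ltW; apply: archi_boundP.
have sav : bsum (fun n => a n w ^+ 2 * v n w ^+ 2).
  apply: (bsum_le_eventually (N := N) _ _ (bsumD (fs k) fars)) => n.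
    by rewrite addr_ge0 //; nonneg.
  move=> Nn; rewrite /f /low (le_trans (HM _) Mk) /= mul1r.
  have a1 : a n w <= 1.
    by have := HN n Nn; rewrite /small; move: eta_half; lra.
  rewrite /near /far (HN n Nn) andbT; case: (flat n w) => /=.
    rewrite mul1r mul0r addr0 expr2 -mulrA; apply: ler_piMl => //.
    exact: mulr_ge0.
  by rewrite !mul0r add0r mul1r.
have [B HB] := sav.
have Sbd n : S n w <= S0 * expR B.
  apply: (@le_trans _ _ (S0 * expR (\sum_(i < n) a i w ^+ 2 * v i w ^+ 2))); last first.
    by rewrite ler_pM2l // ler_expR.
  elim: n => [|n IH]; first by rewrite S_init big_ord0 expR0 mulr1.
  rewrite big_ord_recr /= expRD mulrA.
  have -> : S n.+1 w = S n w * (1 + a n w ^+ 2 * v n w ^+ 2).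
    by rewrite S_rec step_sqr; field; rewrite gt_eqF // S_gt0.
  apply: ler_pM => //; first exact/ltW/S_gt0.
    by rewrite addr_ge0 // mulr_ge0.
  exact: expR_ge1Dx.
have [n0 _ Hn0] : \forall n \near \oo, S0 * expR B + 1 <= S n w by move/cvgryPge: Soo; apply.
have := Hn0 n0 (leqnn n0); have := Sbd n0 => /=; lra.
Qed.

(** A real noise x - m with conditional mean zero, dominated by v and u: it stands
    for one coordinate of the stochastic gradient. *)
Section Coordinate.
Variables x m : nat -> Omega -> R.
Hypothesis mx : forall n, sub_measurable (F n.+1) (x n).
Hypothesis mm : forall n, sub_measurable (F n) (m n).
Hypothesis xv : forall n w, `|x n w| <= v n w.
Hypothesis mu_le : forall n w, `|m n w| <= u n w.
Hypothesis unbiased : forall n (Z : Omega -> R), sub_measurable (F n) Z ->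
  P.-integrable setT (fun w => (Z w * x n w)%:E) ->
  P.-integrable setT (fun w => (Z w * m n w)%:E) ->
  (\int[P]_w (Z w * x n w)%:E = \int[P]_w (Z w * m n w)%:E)%E.

Let tx n : measurable_fun setT (x n). Proof. exact: (@smW n.+1). Qed.
Let tm n : measurable_fun setT (m n). Proof. exact: (@smW n). Qed.
Let tclock n : measurable_fun setT (clock n). Proof. exact: (@smW n). Qed.

(** Square integrability of the multiplier suffices, because x and m are square
    integrable. *)
Lemma centered_noise n (W B : Omega -> R) : sub_measurable (F n) W ->
  measurable_fun setT B -> (forall w, `|W w| <= B w) ->
  (E (fun w => B w ^+ 2)%R < +oo)%E ->
  centered P (fun w => W w * (x n w - m n w)).
Proof.
move=> mW mB WB Bfin; have tW : measurable_fun setT W by exact: (@smW n).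
have dom (y bd : Omega -> R) : measurable_fun setT y -> measurable_fun setT bd ->
    (forall w, `|y w| <= bd w) -> (E (fun w => bd w ^+ 2)%R < +oo)%E ->
    P.-integrable setT (fun w => (W w * y w)%:E).
  move=> my mbd ybd bdfin.
  apply: (@integrable_dom _ _ _ P _ (fun w => B w ^+ 2 + bd w ^+ 2)).
  - by mfun.
  - by mfun.
  - by apply: mean_ltyD => //; [by mfun|by mfun|move=> w; exact: sqr_ge0|move=> w; exact: sqr_ge0].
  move=> w; rewrite normrM; have := WB w; have := ybd w.
  have := normr_ge0 (W w); have := normr_ge0 (y w).
  move: (`|W w|) (`|y w|) (B w) (bd w) => p q b c p0 q0 qc pb.
  have := sqr_ge0 (b - c); have : p * q <= b * c by apply: ler_pM.
  nra.
have iWx := dom _ _ (tx n) (tv n) (xv n) (v2_fin n).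
have iWm := dom _ _ (tm n) (tu n) (mu_le n) (u2_fin n).
under eq_fun do rewrite mulrBr.
exact: centeredB (unbiased mW iWx iWm).
Qed.

Definition far_noise n w : R := far n w * clock n w * (x n w - m n w).
Definition far_avg := forget clock far_noise.

Lemma measurable_far_avg n : sub_measurable (F n) (far_avg n).
Proof.
elim: n => [|n IH]; first exact: measurable_cst.
have sIH := up IH; have s1 := up (@mclock n); have s2 := up (@mfar n).
have s3 := up (@mm n); have s4 := @mx n.
by rewrite /far_avg /= /far_noise; mfun.
Qed.
Let mfa := measurable_far_avg.
Let tfa n : measurable_fun setT (far_avg n). Proof. exact: (@smW n). Qed.

Let far_noise_sqr n w : far_noise n w ^+ 2 <=
  2 * (far n w * (a n w ^+ 2 * v n w ^+ 2)) + 2 * (a n w ^+ 2 * u n w ^+ 2).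
Proof.
have sqle (p q : R) : `|p| <= q -> p ^+ 2 <= q ^+ 2.
  move=> pq; rewrite -[p ^+ 2]real_normK ?num_real // ler_sqr ?nnegrE //.
  exact: le_trans pq.
have x2 := sqle _ _ (xv n w); have m2 := sqle _ _ (mu_le n w).
rewrite /far_noise /far /clock; case: (flat n w) => /=.
  by rewrite !mul0r expr0n /= mulr0 add0r !mulr_ge0.
rewrite !mul1r; case: (small n w) => /=.
  rewrite mul1r exprMn; apply: (le_trans (ler_wpM2l (aa0 n w) (sqrB_le2 _ _))).
  have := ler_wpM2l (aa0 n w) (lerD x2 m2); lra.
by rewrite !mul0r expr0n /= addr_ge0 // !mulr_ge0.
Qed.

Let far_avg_fin n : (E (fun w => far_avg n w ^+ 2)%R < +oo)%E.
Proof.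
elim: n => [|n IH].
  rewrite (eq_mean P (g := fun=> 0)) ?mean_cst ?ltry // => w.
  by rewrite /far_avg /= expr0n.
apply: (@le_lt_trans _ _ (E (fun w => 2 * far_avg n w ^+ 2 +
   2 * (2 * (far n w * (a n w ^+ 2 * v n w ^+ 2)) + 2 * (a n w ^+ 2 * u n w ^+ 2))))).
  apply: mean_le; [by mfun|by mfun|by move=> w; exact: sqr_ge0|].
  move=> w; rewrite /far_avg /=; apply: (le_trans (sqrD_le2 _ _)).
  rewrite mulrDr lerD //; last by rewrite ler_pM2l.
  rewrite ler_pM2l // exprMn ler_piMl ?sqr_ge0 //.
  rewrite exprn_ile1 // ?subr_ge0 // lerBlDr lerDl //.
have c0 : 0 <= step0 by apply: le_trans (step_le0 0 point); exact: a0.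
have sq2 : forall w : Omega, a n w ^+ 2 <= step0 ^+ 2.
  by move=> w; rewrite ler_sqr ?nnegrE // step_le0.
have fle w : far n w <= 1 by rewrite /far; case: flat.
apply: (@le_lt_trans _ _ (E (fun w => 2 * far_avg n w ^+ 2 +
   (4 * step0 ^+ 2 * v n w ^+ 2 + 4 * step0 ^+ 2 * u n w ^+ 2)))).
  apply: mean_le; [by mfun|by mfun| |].
    by move=> w; nonneg.
  move=> w; rewrite lerD2l.
  have h1 : far n w * (a n w ^+ 2 * v n w ^+ 2) <= step0 ^+ 2 * v n w ^+ 2.
    rewrite -[leRHS]mul1r; apply: ler_pM => //; first by rewrite mulr_ge0.
    exact: ler_wpM2r.
  have h2 : a n w ^+ 2 * u n w ^+ 2 <= step0 ^+ 2 * u n w ^+ 2 by exact: ler_wpM2r.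
  lra.
have z0 : 0 <= 4 * step0 ^+ 2 by rewrite mulr_ge0 ?sqr_ge0.
have X0 w : 0 <= far_avg n w ^+ 2 by exact: sqr_ge0.
have fin2 (k : R) (f : Omega -> R) : measurable_fun setT f -> 0 <= k ->
    (E (fun w => f w ^+ 2)%R < +oo)%E -> (E (fun w => k * f w ^+ 2)%R < +oo)%E.
  by move=> mf k0; apply: mean_ltyZ => //; [by mfun|move=> w; exact: sqr_ge0].
apply: mean_ltyD; [by mfun|by mfun|by move=> w; nonneg|by move=> w; nonneg|exact: fin2|].
apply: mean_ltyD; [by mfun|by mfun|by move=> w; nonneg|by move=> w; nonneg|exact: fin2|exact: fin2].
Qed.

(** The square of the average: its cross term is centred, and the squared noise has
    summable mean by [far_summable] and the energy estimate. *)
Lemma far_avg_cvg0 : {ae P, forall w, ~ bsum (clock ^~ w) ->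
  forall e, 0 < e -> exists N, forall n, (N <= n)%N -> `|far_avg n w| <= e}.
Proof.
pose err n w := 2 * (far n w * (a n w ^+ 2 * v n w ^+ 2)) + 2 * (a n w ^+ 2 * u n w ^+ 2).
have terr n : measurable_fun setT (err n) by rewrite /err; mfun.
have err0 n w : 0 <= err n w by rewrite /err !(addr_ge0, mulr_ge0).
have := @robbins_siegmund _ _ _ P F (fun n w => far_avg n w ^+ 2) clock (fun n => E (err n)) filt.
move=> /(_ (fun n w => sqr_ge0 _) clock_ge0) RS.
have {RS} := RS (fun n => measurable_funX _ (@mfa n)) mclock.
move=> RS; have {RS} : {ae P, forall w, ~ bsum (clock ^~ w) ->
  forall e, 0 < e -> exists N, forall n, (N <= n)%N -> far_avg n w ^+ 2 <= e}.
  apply: RS.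
  - move=> n phi mphi phi01.
    have p0 w : 0 <= phi w by have /andP[] := phi01 w.
    have p1 w : phi w <= 1 by have /andP[] := phi01 w.
    have tphi : measurable_fun setT phi by exact: (@smW n).
    have X0 k w : 0 <= far_avg k w ^+ 2 by exact: sqr_ge0.
    have A1 : measurable_fun setT (fun w => phi w * far_avg n.+1 w ^+ 2) by mfun.
    have A2 : measurable_fun setT (fun w => phi w * (clock n w * far_avg n w ^+ 2)) by mfun.
    have A3 : measurable_fun setT (fun w => phi w * far_avg n w ^+ 2) by mfun.
    have B1 w : 0 <= phi w * far_avg n.+1 w ^+ 2 by nonneg.
    have B2 w : 0 <= phi w * (clock n w * far_avg n w ^+ 2) by nonneg.
    have B3 w : 0 <= phi w * far_avg n w ^+ 2 by nonneg.
    rewrite -(meanD P A1 A2 B1 B2) -(meanD P A3 (@terr n) B3 (err0 n)).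
    pose W w := 2 * phi w * (1 - clock n w) * far_avg n w * (far n w * clock n w).
    have mW : sub_measurable (F n) W by rewrite /W; mfun.
    have c1 w : 0 <= 1 - clock n w by rewrite subr_ge0.
    have fc w : 0 <= far n w * clock n w <= 1.
      rewrite mulr_ge0 //= mulr_ile1 //.
      by rewrite /far; case: flat.
    have cN : centered P (fun w => W w * (x n w - m n w)).
      apply: (@centered_noise n W (fun w => 2 * `|far_avg n w|)) => //.
      + by apply: measurable_funM => //; exact: measurableT_comp.
      + move=> w; have /andP[fc0 fc1] := fc w.
        have k0 : 0 <= phi w * (1 - clock n w) * (far n w * clock n w) by rewrite !mulr_ge0.
        have k1 : phi w * (1 - clock n w) * (far n w * clock n w) <= 1.
          have d1 : 1 - clock n w <= 1 by rewrite lerBlDr lerDl.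
          by apply: mulr_ile1 => //; [exact: mulr_ge0 | exact: mulr_ile1].
        rewrite /W (_ : 2 * phi w * (1 - clock n w) * far_avg n w * (far n w * clock n w) =
          2 * (phi w * (1 - clock n w) * (far n w * clock n w)) * far_avg n w); last by ring.
        rewrite normrM ger0_norm ?mulr_ge0 //; apply: ler_wpM2r => //; lra.
      + rewrite (eq_mean P (g := fun w => 4 * far_avg n w ^+ 2)).
          by apply: mean_ltyZ => //; mfun.
        by move=> w; rewrite exprMn real_normK ?num_real //; congr (_ * _); ring.
    apply: (@mean_le_centered _ _ _ P _ _ _ _ _ _ _ cN); [by mfun|by mfun| | |].
    + by move=> w; exact: addr_ge0.
    + by move=> w; exact: addr_ge0.
    + move=> w; have := far_noise_sqr n w; rewrite -/(err n w).
      rewrite /W /far_avg /= -/far_avg.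
      have -> : far_noise n w = far n w * clock n w * (x n w - m n w) by [].
      have -> : 2 * phi w * (1 - clock n w) * far_avg n w * (far n w * clock n w) *
          (x n w - m n w) = 2 * phi w * (1 - clock n w) * far_avg n w *
          (far n w * clock n w * (x n w - m n w)) by ring.
      move: (far n w * clock n w * (x n w - m n w)) (far_avg n w) (err0 n w) => q z.
      move: (clock n w) (clock_ge0 n w) (clock_le1 n w) => c c0 c1'.
      move: (phi w) (err n w) (p0 w) (p1 w) => f e f0 f1 e0 qe.
      have h1 : f * q ^+ 2 <= e by apply: le_trans qe; rewrite ler_piMl ?sqr_ge0.
      have h2 : 0 <= f * (c * (1 - c) * z ^+ 2).
        have d0 : 0 <= 1 - c by rewrite subr_ge0.
        by nonneg.
      lra.
  - rewrite (eq_mean P (g := fun=> 0)) ?mean_cst ?ltry // => w.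
    by rewrite /far_avg /= expr0n.
  - pose f1 n w := far n w * (a n w ^+ 2 * v n w ^+ 2).
    pose f2 n w := a n w ^+ 2 * u n w ^+ 2.
    have m1 n : measurable_fun setT (f1 n) by rewrite /f1; mfun.
    have m2 n : measurable_fun setT (f2 n) by rewrite /f2; mfun.
    have p1 n w : 0 <= f1 n w by rewrite /f1; nonneg.
    have p2 n w : 0 <= f2 n w by rewrite /f2; nonneg.
    apply: (@bsume_le _ _ (fun n => E (f1 n) + E (f2 n))%E 2) => // [n|n|].
    + by rewrite adde_ge0 //; exact: mean_ge0.
    + rewrite -(meanD P (m1 n) (m2 n) (p1 n) (p2 n)) -meanZ //; first last.
      * by move=> w; exact: addr_ge0.
      * by mfun.
      by rewrite le_eqVlt (eq_mean P (g := err n)) ?eqxx // => w; rewrite /err mulrDr.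
    + exact: bsumeD far_summable energy.
apply: filterS => w H nc e e0; have [N HN] := H nc _ (exprn_gt0 2 e0).
exists N => n Nn; have := HN n Nn.
by rewrite -[leLHS]real_normK ?num_real // ler_sqr ?nnegrE // ltW.
Qed.

(** Truncation keeps the near noise bounded, so that the moment of order 2 + r
    suffices for its fourth powers.  Only x is truncated: the mean of the truncated
    noise is then not zero, but its deviation is of the order of the noise cut
    off. *)
Definition kept n w : R := ((a n w * v n w <= 1)%R)%:R.
Definition near_noise n w : R := near n w * a n w * (x n w * kept n w - m n w).
Definition near_avg := forget clock near_noise.

Let mkept n : sub_measurable (F n.+1) (kept n).
Proof.
apply: measurable_natr_bool; have h1 := up (@ma n); have h2 := @mv n.
by apply: measurable_fun_ler; mfun.
Qed.
Let tkept n : measurable_fun setT (kept n). Proof. exact: (@smW n.+1). Qed.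

Lemma measurable_near_avg n : sub_measurable (F n) (near_avg n).
Proof.
elim: n => [|n IH]; first exact: measurable_cst.
have sIH := up IH; have s1 := up (@mclock n); have s2 := up (@mnear n).
have s3 := up (@mm n); have s4 := @mx n; have s5 := up (@ma n).
by rewrite /near_avg /= /near_noise; mfun.
Qed.
Let mna := measurable_near_avg.
Let tna n : measurable_fun setT (near_avg n). Proof. exact: (@smW n). Qed.

Let near_avg_bd n : exists B, forall w, `|near_avg n w| <= B.
Proof.
elim: n => [|n [B HB]]; first by exists 0 => w; rewrite /near_avg /= normr0.
exists (B + (1 + delta)) => w; rewrite /near_avg /=.
apply: (le_trans (ler_normD _ _)); apply: lerD.
  rewrite normrM ger0_norm ?subr_ge0 //; apply: le_trans (HB w).
  by rewrite ler_piMl // lerBlDr lerDl.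
rewrite /near_noise; case: (near_cases n w) => [->|[-> ud _ a1]].
  by rewrite !mul0r normr0 addr_ge0 // ltW.
rewrite mul1r mulrBr; apply: (le_trans (ler_normB _ _)); apply: lerD.
  rewrite /kept normrM (ger0_norm (a0 n w)); case: (leP (a n w * v n w) 1) => av /=.
    by rewrite mulr1; apply: le_trans av; apply: ler_wpM2l.
  by rewrite mulr0 normr0 mulr0.
rewrite normrM (ger0_norm (a0 n w)); apply: le_trans ud.
apply: le_trans (mu_le n w); exact: ler_piMl.
Qed.

(* C0 bounds the conditional mean of v^2 where the gradient is small.  The factor of
   a^2 Y in [near_step_le], in mean 18 C0 + 16 delta^2, is K / 4; as K a Y <= y^4,
   these terms stay below a y^4 / 4. *)
Let C0 := beta * delta ^+ 2 + s.
Let K := 4 * (18 * C0 + 16 * delta ^+ 2).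
Let C0_gt0 : 0 < C0. Proof. by rewrite /C0 ltr_wpDl // mulr_ge0 ?sqr_ge0. Qed.
Let K_gt0 : 0 < K.
Proof. by rewrite /K mulr_gt0 // addr_gt0 // mulr_gt0 // exprn_gt0. Qed.

Let jump n w := near n w * (a n w ^+ 2 * a n w `^ r) * (v n w ^+ 2 * v n w `^ r).
Let tjump n : measurable_fun setT (jump n). Proof. by rewrite /jump; mfun. Qed.
Let jump_ge0 n w : 0 <= jump n w. Proof. by rewrite /jump !mulr_ge0. Qed.

(* fourth powers of numbers in [0, 1] are below powers of order 2 + r *)
Let jump_small n w : near n w = 1 -> a n w * v n w <= 1 -> (a n w * v n w) ^+ 4 <= jump n w.
Proof.
move=> nw av; rewrite /jump nw mul1r.
have av0 : 0 <= a n w * v n w by rewrite mulr_ge0.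
have -> : a n w ^+ 2 * a n w `^ r * (v n w ^+ 2 * v n w `^ r) =
   (a n w * v n w) ^+ 2 * (a n w * v n w) `^ r by rewrite powRM //; ring.
rewrite (_ : (a n w * v n w) ^+ 4 = (a n w * v n w) ^+ 2 * (a n w * v n w) ^+ 2); last by ring.
apply: ler_wpM2l; first exact: sqr_ge0.
move: av0 av; move: (a n w * v n w) => t; rewrite le_eqVlt => /orP[/eqP <- _|t0 t1].
  by rewrite expr0n /= powR_ge0.
apply: (@le_trans _ _ t); last by apply: ger1_powR => //; rewrite t0 t1.
by rewrite expr2 ler_piMl // ltW.
Qed.

Let err n w := 18 * K * (near n w * a n w ^+ 3 * v n w ^+ 2) + 24 * jump n w +
  (24 * delta ^+ 2 + 16 * K) * (a n w ^+ 2 * u n w ^+ 2).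
Let terr n : measurable_fun setT (err n). Proof. by rewrite /err; mfun. Qed.
Let cu0 : 0 <= 24 * delta ^+ 2 + 16 * K.
Proof. by rewrite addr_ge0 // mulr_ge0 ?sqr_ge0 // ltW. Qed.
Let K0 : 0 <= K. Proof. exact: ltW. Qed.
Let a30 n w : 0 <= a n w ^+ 3. Proof. exact: exprn_ge0. Qed.
Let err_ge0 n w : 0 <= err n w.
Proof. by rewrite /err; nonneg. Qed.

Let err_summable : bsume (fun n => E (err n)).
Proof.
have n0 n w : 0 <= near n w * a n w ^+ 3 * v n w ^+ 2 by rewrite !mulr_ge0.
have e0 n w : 0 <= a n w ^+ 2 * u n w ^+ 2 by rewrite mulr_ge0.
have K18 : 0 <= 18 * K by rewrite mulr_ge0.
pose e1 n := E (fun w => near n w * a n w ^+ 3 * v n w ^+ 2).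
pose e2 n := E (jump n).
pose e3 n := E (fun w => a n w ^+ 2 * u n w ^+ 2).
have e1_0 n : (0 <= e1 n)%E by apply: mean_ge0 => w; nonneg.
have e2_0 n : (0 <= e2 n)%E by exact: mean_ge0.
have e3_0 n : (0 <= e3 n)%E by apply: mean_ge0 => w; nonneg.
have H n : (E (err n) = (18 * K)%:E * e1 n + 24%:E * e2 n +
   (24 * delta ^+ 2 + 16 * K)%:E * e3 n)%E.
  rewrite /e1 /e2 /e3 -!meanZ //; try by mfun.
  rewrite -meanD; [|by mfun|by mfun|by move=> w; nonneg|by move=> w; nonneg].
  by rewrite -meanD; [|by mfun|by mfun|by move=> w; nonneg|by move=> w; nonneg].
apply: (@bsume_le _ _ (fun n => (18 * K)%:E * e1 n + 24%:E * e2 n +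
   (24 * delta ^+ 2 + 16 * K)%:E * e3 n)%E 1) => //.
- by move=> n; rewrite !adde_ge0 // mule_ge0 ?lee_fin.
- by move=> n; rewrite mul1e H.
- apply: bsumeD; [apply: bsumeD|].
  + exact: (bsume_le K18 e1_0 (fun n => lexx _) near_summable3).
  + exact: (bsume_le (ler0n _ 24) e2_0 (fun n => lexx _) near_summable_jump).
  + exact: (bsume_le cu0 e3_0 (fun n => lexx _) energy).
Qed.

(* Of the drift a z^4 >= a y^4, the terms in Y use a quarter and those in a^2 y^4 another
   quarter, since 8 C0 a <= 1; one half remains. *)
Let near_drift n (phi : Omega -> R) : sub_measurable (F n) phi ->
  (forall w, 0 <= phi w <= 1) ->
  (E (fun w => phi w * near_avg n.+1 w ^+ 4)%R +
   E (fun w => phi w * (2^-1 * clock n w * near_avg n w ^+ 4))%R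
   <= E (fun w => phi w * near_avg n w ^+ 4)%R + E (err n))%E.
Proof.
move=> mphi phi01.
have p0 w : 0 <= phi w by have /andP[] := phi01 w.
have p1 w : phi w <= 1 by have /andP[] := phi01 w.
have tphi : measurable_fun setT phi by exact: (@smW n).
have p40 (z : R) : 0 <= z ^+ 4 by exact: exprn_even_ge0.
pose z w := near_avg n w.
pose y w := (1 - clock n w) * z w.
have my : sub_measurable (F n) y by rewrite /y /z; mfun.
have ty : measurable_fun setT y by exact: (@smW n).
have tz : measurable_fun setT z by exact: tna.
pose big w : R := ((K * a n w < y w ^+ 2)%R)%:R.
have mbig : sub_measurable (F n) big.
  by apply: measurable_natr_bool; apply: measurable_fun_ltr; mfun.
have tbig : measurable_fun setT big by exact: (@smW n).
pose Y w := big w * y w ^+ 2.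
have Y0 w : 0 <= Y w by rewrite mulr_ge0 ?sqr_ge0 // ler0n.
have yY w : y w ^+ 2 <= K * a n w + Y w.
  rewrite /Y /big; case: ltP => /= h; first by rewrite mul1r lerDr mulr_ge0.
  by rewrite mul0r addr0.
have YK w : K * a n w * Y w <= y w ^+ 4.
  rewrite /Y /big; case: ltP => /= h; last by rewrite mul0r mulr0.
  rewrite mul1r (_ : y w ^+ 4 = y w ^+ 2 * y w ^+ 2); last by ring.
  by apply: ler_wpM2r; [exact: sqr_ge0|exact: ltW].
(* the part of the bound that is linear in v^2 *)
pose V w := phi w * near n w * a n w ^+ 2 * (2 * y w ^+ 4 + 18 * Y w).
have V0 w : 0 <= V w by rewrite /V; nonneg.
have mV : sub_measurable (F n) V by rewrite /V /Y; mfun.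
have tV : measurable_fun setT V by exact: (@smW n).
pose W w := 4 * phi w * near n w * a n w * y w ^+ 3.
have mW : sub_measurable (F n) W by rewrite /W; mfun.
have cN : centered P (fun w => W w * (x n w - m n w)).
  have [B HB] := near_avg_bd n.
  apply: (@centered_noise n W (fun=> 4 * B ^+ 3)) => //.
    move=> w; have B0 : 0 <= B by apply: le_trans (HB w).
    have yB : `|y w| <= B.
      rewrite /y normrM ger0_norm ?subr_ge0 //; apply: le_trans (HB w).
      by rewrite ler_piMl // lerBlDr lerDl.
    have H0 : 0 <= phi w * (near n w * a n w) by rewrite !mulr_ge0.
    have H1 : phi w * (near n w * a n w) <= 1.
      rewrite mulr_ile1 ?mulr_ge0 //.
      by case: (near_cases n w) => [->|[-> _ _ a1]]; rewrite ?mul0r ?mul1r.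
    rewrite /W (_ : 4 * phi w * near n w * a n w * y w ^+ 3 =
      4 * (phi w * (near n w * a n w)) * y w ^+ 3); last by ring.
    rewrite normrM ger0_norm ?mulr_ge0 // normrX.
    by apply: ler_pM; rewrite ?mulr_ge0 ?exprn_ge0 ?lerXn2r ?nnegrE //; lra.
  by rewrite mean_cst ltry.
have path w : phi w * near_avg n.+1 w ^+ 4 + phi w * (2^-1 * clock n w * z w ^+ 4) <=
   W w * (x n w - m n w) +
   (phi w * ((1 - 2^-1 * clock n w) * z w ^+ 4) +
    phi w * (near n w * (16 * delta ^+ 2 * (a n w ^+ 2 * Y w))) + V w * v n w ^+ 2 + err n w).
  have -> : near_avg n.+1 w = y w + near_noise n w by [].
  have y4 : y w ^+ 4 <= (1 - clock n w) * z w ^+ 4.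
    rewrite /y exprMn; apply: ler_wpM2r => //.
    have c1 : 0 <= 1 - clock n w by rewrite subr_ge0.
    by rewrite exprS ler_piMr // exprn_ile1 // lerBlDr lerDl.
  have [n0|[n1 ud _ a1]] := near_cases n w.
    rewrite /W /V /near_noise n0 !(mulr0, mul0r, addr0, add0r).
    have := ler_wpM2l (p0 w) y4; have := err_ge0 n w; lra.
  have x'E : x n w * kept n w = (if a n w * v n w <= 1 then x n w else 0).
    by rewrite /kept; case: ifP => _; rewrite /= ?mulr1 ?mulr0.
  have := near_step_le (a0 n w) a1 (v0 n w) (xv n w) (mu_le n w) ud K0 (Y0 w) (yY w)
    (jump_ge0 n w) (jump_small n1) x'E.
  rewrite /W /V /near_noise /err n1 !(mul1r, mulr1).
  set q := a n w * _; set Q := (y w + q) ^+ 4.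
  move=> H; have {H} := ler_wpM2l (p0 w) (lerD H y4).
  have := ler_wpM2r (err_ge0 n w) (p1 w); rewrite /err n1 !mul1r.
  lra.
pose L w := phi w * near_avg n.+1 w ^+ 4 + phi w * (2^-1 * clock n w * z w ^+ 4).
pose g1 w := phi w * ((1 - 2^-1 * clock n w) * z w ^+ 4).
pose g2 w := phi w * (near n w * (16 * delta ^+ 2 * (a n w ^+ 2 * Y w))).
pose g3 w := V w * v n w ^+ 2.
pose g4 w := V w * (beta * u n w ^+ 2 + s).
have hc w : 0 <= 1 - 2^-1 * clock n w.
  by have := clock_le1 n w; have := clock_ge0 n w; lra.
have h2 : 0 <= 2^-1 :> R by rewrite invr_ge0.
have tY : measurable_fun setT Y by rewrite /Y; mfun.
have A1 : measurable_fun setT (fun w => phi w * near_avg n.+1 w ^+ 4) by mfun.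
have A2 : measurable_fun setT (fun w => phi w * (2^-1 * clock n w * z w ^+ 4)) by mfun.
have A3 : measurable_fun setT g1 by rewrite /g1; mfun.
have A4 : measurable_fun setT g2 by rewrite /g2; mfun.
have A5 : measurable_fun setT g3 by rewrite /g3; mfun.
have A6 : measurable_fun setT g4 by rewrite /g4; mfun.
have B1 w : 0 <= phi w * near_avg n.+1 w ^+ 4 by exact: mulr_ge0.
have B2 w : 0 <= phi w * (2^-1 * clock n w * z w ^+ 4) by nonneg.
have B3 w : 0 <= g1 w by apply: mulr_ge0 => //; exact: mulr_ge0.
have B4 w : 0 <= g2 w by rewrite /g2; nonneg.
have B5 w : 0 <= g3 w by rewrite /g3; nonneg.
have B6 w : 0 <= g4 w by rewrite /g4; nonneg.
have A12 : measurable_fun setT (fun w => g1 w + g2 w) by mfun.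
have B12 w : 0 <= g1 w + g2 w by exact: addr_ge0.
have A123 : measurable_fun setT (fun w => g1 w + g2 w + g3 w) by mfun.
have B123 w : 0 <= g1 w + g2 w + g3 w by exact: addr_ge0.
have A1234 : measurable_fun setT (fun w => g1 w + g2 w + g3 w + err n w) by mfun.
have B1234 w : 0 <= g1 w + g2 w + g3 w + err n w by exact: addr_ge0.
rewrite -(meanD P A1 A2 B1 B2).
have tL : measurable_fun setT L by rewrite /L; mfun.
have L0 w : 0 <= L w by rewrite /L; exact: addr_ge0.
apply: (le_trans (mean_le_centered tL A1234 L0 B1234 cN path)).
rewrite (meanD P A123 (@terr n) B123 (err_ge0 n)); apply: leeD => //.
rewrite (meanD P A12 A5 B12 B5).
apply: (le_trans (leeD (lexx _) (moment2 mV V0))).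
rewrite -(meanD P A12 A6 B12 B6).
apply: mean_le; [by mfun|by mfun|by move=> w; exact: addr_ge0|].
move=> w; rewrite /g1 /g2 /g4 /V.
have zy : y w ^+ 4 <= z w ^+ 4.
  rewrite /y exprMn ler_piMl // exprn_ile1 // ?subr_ge0 //.
  by rewrite lerBlDr lerDl.
have [n0|[n1 ud ae a1]] := near_cases n w.
  rewrite n0 !(mulr0, mul0r, addr0); apply: ler_wpM2l => //.
  by rewrite ler_piMl // lerBlDr lerDl mulr_ge0.
have cE : clock n w = a n w by rewrite /clock /small ae mul1r.
rewrite n1 cE !(mul1r, mulr1).
have hC : beta * u n w ^+ 2 + s <= C0.
  rewrite /C0 lerD2r; apply: ler_wpM2l => //.
  by rewrite ler_sqr ?nnegrE // ltW.
have yY0 : 0 <= 2 * y w ^+ 4 + 18 * Y w by rewrite addr_ge0 // mulr_ge0.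
have k1 : a n w ^+ 2 * (2 * y w ^+ 4 + 18 * Y w) * (beta * u n w ^+ 2 + s) <=
    a n w ^+ 2 * (2 * y w ^+ 4 + 18 * Y w) * C0 by apply: ler_wpM2l => //; exact: mulr_ge0.
have k2 : 8 * C0 * a n w <= 1.
  by apply: le_trans eta_C0; apply: ler_wpM2l => //; rewrite mulr_ge0 // ltW.
have k3 : 8 * C0 * a n w * (a n w * y w ^+ 4) <= a n w * y w ^+ 4.
  by apply: ler_piMl => //; exact: mulr_ge0.
have k4 : a n w * (K * a n w * Y w) <= a n w * y w ^+ 4 by exact: ler_wpM2l.
have k5 : a n w * y w ^+ 4 <= a n w * z w ^+ 4 by exact: ler_wpM2l.
have key : (1 - 2^-1 * a n w) * z w ^+ 4 + 16 * delta ^+ 2 * (a n w ^+ 2 * Y w) +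
   a n w ^+ 2 * (2 * y w ^+ 4 + 18 * Y w) * C0 <= z w ^+ 4.
  move: k3 k4 k5; rewrite /K; lra.
have := ler_wpM2l (p0 w) key.
have := ler_wpM2l (p0 w) k1.
rewrite -/(z w); lra.
Qed.

Lemma near_avg_cvg0 : {ae P, forall w, ~ bsum (clock ^~ w) ->
  forall e, 0 < e -> exists N, forall n, (N <= n)%N -> `|near_avg n w| <= e}.
Proof.
have h2 : 0 <= 2^-1 :> R by rewrite invr_ge0.
have RS : {ae P, forall w, ~ bsum (fun n => 2^-1 * clock n w) ->
  forall e, 0 < e -> exists N, forall n, (N <= n)%N -> near_avg n w ^+ 4 <= e}.
  apply: (@robbins_siegmund _ _ _ P F (fun n w => near_avg n w ^+ 4)
    (fun n w => 2^-1 * clock n w) (fun n => E (err n)) filt).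
  - by move=> n w; exact: exprn_even_ge0.
  - by move=> n w; exact: mulr_ge0.
  - by move=> n; have := @mna n => H; mfun.
  - by move=> n; have := @mclock n => H; mfun.
  - exact: near_drift.
  - rewrite (eq_mean P (g := fun=> 0)) ?mean_cst ?ltry // => w.
    by rewrite /near_avg /= expr0n.
  - exact: err_summable.
apply: filterS RS => w H nc e e0.
have nc2 : ~ bsum (fun n => 2^-1 * clock n w).
  move=> sc; apply: nc; apply: (bsum_le (C := 2)) sc => // n.
  by rewrite mulrA mulfV // mul1r.
have [N HN] := H nc2 _ (exprn_gt0 4 e0).
exists N => n Nn; have := HN n Nn.
have -> : near_avg n w ^+ 4 = `|near_avg n w| ^+ 4.
  by rewrite -[4%N]/(2 * 2)%N !exprM real_normK ?num_real.
by rewrite ler_pXn2r ?nnegrE // ltW.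
Qed.

(** Bound for what the far and near noises leave out: truncation, and the use of the
    predictable step in place of the actual one. *)
Definition rest n w : R :=
  2 * (far n w * (a n w ^+ 2 * v n w ^+ 2)) + 2 * (a n w ^+ 2 * u n w ^+ 2)
  + 2 * jump n w + delta * (a n w - a n.+1 w).

Lemma rest_ge0 n w : 0 <= rest n w.
Proof.
have d0 := ltW delta0; have q0 : 0 <= a n w - a n.+1 w by rewrite subr_ge0 step_anti.
by rewrite /rest; nonneg.
Qed.

Lemma rest_summable : {ae P, forall w, bsum (rest ^~ w)}.
Proof.
have q0 n w : 0 <= a n w - a n.+1 w by rewrite subr_ge0 step_anti.
have s1 : {ae P, forall w, bsum (fun n => far n w * (a n w ^+ 2 * v n w ^+ 2))}.
  by apply: bsume_ae far_summable => [?|? ?]; [mfun|nonneg].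
have s2 : {ae P, forall w, bsum (fun n => a n w ^+ 2 * u n w ^+ 2)}.
  by apply: bsume_ae energy => [?|? ?]; [mfun|nonneg].
have s3 : {ae P, forall w, bsum (jump ^~ w)}.
  exact: bsume_ae near_summable_jump.
have s4 : {ae P, forall w, bsum (fun n => a n w - a n.+1 w)}.
  by apply: bsume_ae gap_summable => [?|//]; mfun.
apply: filterS2 (filterI s1 s2) (filterI s3 s4) => w [t1 t2] [t3 t4].
have dbl (f : nat -> R) : bsum f -> bsum (fun n => 2 * f n).
  by move=> bf; apply: (bsum_le (C := 2)) bf.
apply: bsumD; last by apply: (bsum_le (C := delta)) t4 => //; exact: ltW.
by apply: bsumD; [apply: bsumD|]; exact: dbl.
Qed.

(** With D = a_n - a_(n+1), the difference is D (x - m) plus the noise cut off.  The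
    drift D m is at most delta D on the near part; D v is below the terms of order
    2 + r there, because D <= a^3 v^2 and D <= a; on the far part D (x - m) is
    quadratic, because D <= a (a v). *)
Lemma noise_split n w : small n w ->
  `|a n.+1 w * (x n w - m n w) - (far_noise n w + near_noise n w)| <= rest n w.
Proof.
move=> sn; have a1 : a n w <= 1 by move: sn eta_half; rewrite /small; lra.
have q0 : 0 <= a n w - a n.+1 w by rewrite subr_ge0 step_anti.
have b0 := ltW (step_gt0 n.+1 w).
have av0 : 0 <= a n w * v n w by exact: mulr_ge0.
have gu := gap_upper (step_gt0 n.+1 w) (step_anti n w) (step_gap n w).
have xn := xv n w; have mn := mu_le n w; have un := u0 n w.
have qle : a n w - a n.+1 w <= a n w by rewrite gerBl.
pose D := a n w - a n.+1 w.
have bE : a n.+1 w = a n w - D by rewrite /D opprB addrC subrK.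
rewrite /rest /far_noise /near_noise /clock sn mul1r.
case fl: (flat n w); rewrite /far /near /jump /near fl sn /=; last first.
  rewrite !(mul0r, mulr0, addr0, mul1r) bE.
  have -> : (a n w - D) * (x n w - m n w) - a n w * (x n w - m n w)
    = - (D * (x n w - m n w)) by ring.
  rewrite normrN normrM (ger0_norm q0).
  have H1 : D <= a n w * (a n w * v n w).
    have [av|av] := leP (a n w * v n w) 1; last first.
      by apply: (le_trans qle); apply: ler_peMr => //; exact: ltW.
    apply: (le_trans gu); have := ler_wpM2l (mulr_ge0 (a0 n w) av0) av; lra.
  have H2 : `|x n w - m n w| <= v n w + u n w.
    by apply: (le_trans (ler_normB _ _)); exact: lerD.
  have H3 := ler_pM q0 (normr_ge0 _) H1 H2.
  apply: (le_trans H3).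
  have := mulr_ge0 (ltW delta0) q0; rewrite -/D.
  have := sqr_ge0 (a n w * v n w - a n w * u n w); nra.
rewrite !(mul0r, mulr0, add0r, mul1r) bE.
have -> : (a n w - D) * (x n w - m n w) - a n w * (x n w * kept n w - m n w)
  = a n w * x n w * (1 - kept n w) - D * x n w + D * m n w by ring.
have Dm : `|D * m n w| <= delta * D.
  rewrite normrM (ger0_norm q0) mulrC; apply: ler_wpM2r => //; exact: le_trans fl.
have Dx : `|D * x n w| <= D * v n w by rewrite normrM (ger0_norm q0); exact: ler_wpM2l.
have J0 : 0 <= a n w ^+ 2 * u n w ^+ 2 by exact: mulr_ge0.
have -> : a n w ^+ 2 * a n w `^ r * (v n w ^+ 2 * v n w `^ r) =
   (a n w * v n w) ^+ 2 * (a n w * v n w) `^ r by rewrite powRM //; ring.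
suff H : `|a n w * x n w * (1 - kept n w) - D * x n w| <=
    2 * ((a n w * v n w) ^+ 2 * (a n w * v n w) `^ r).
  apply: (le_trans (ler_normD _ _)); rewrite -/D; lra.
rewrite /kept; have [av|av] := leP (a n w * v n w) 1.
  rewrite /= subrr mulr0 sub0r normrN; apply: (le_trans Dx).
  apply: (@le_trans _ _ ((a n w * v n w) ^+ 2 * (a n w * v n w))).
    have := ler_wpM2r (v0 n w) gu; rewrite -/D; lra.
  have H : (a n w * v n w) <= (a n w * v n w) `^ r.
    move: av0 av; move: (a n w * v n w) => t; rewrite le_eqVlt => /orP[/eqP <- _|t0 t1].
      exact: powR_ge0.
    by apply: ger1_powR => //; rewrite t0 t1.
  have H' := ler_wpM2l (sqr_ge0 (a n w * v n w)) H.
  have : 0 <= (a n w * v n w) ^+ 2 * (a n w * v n w) by rewrite mulr_ge0 ?sqr_ge0.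
  lra.
rewrite /= subr0 mulr1; apply: (le_trans (ler_normB _ _)).
have t1 := ltW av.
have H : a n w * v n w <= (a n w * v n w) ^+ 2 * (a n w * v n w) `^ r.
  rewrite expr2 -mulrA; apply: ler_peMr => //.
  rewrite -[leLHS]mul1r; apply: ler_pM => //.
  by rewrite -one_powR; apply: ge0_ler_powR; rewrite ?nnegrE //; exact: ltW.
have H1 : `|a n w * x n w| <= a n w * v n w.
  by rewrite normrM (ger0_norm (a0 n w)); exact: ler_wpM2l.
have H2 : D * v n w <= a n w * v n w by exact: ler_wpM2r.
lra.
Qed.

(** The far and near averages vanish because the clock diverges where S tends to
    infinity; the remainder is a tail of a convergent series. *)
Theorem noise_window : {ae P, forall w, S n w @[n --> \oo] --> +oo ->
  forall tau e, 0 <= tau -> 0 < e -> exists N, forall i k, (N <= i)%N -> (i <= k)%N ->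
    \sum_(i <= j < k) a j w <= tau ->
    `|\sum_(i <= j < k) a j.+1 w * (x j w - m j w)| <= e}.
Proof.
apply: filterS2 (filterI far_avg_cvg0 near_avg_cvg0) (filterI rest_summable clock_diverges).
move=> w [cf cn] [sr cd] Soo tau e tau0 e0.
have nc := cd Soo.
pose e' := e / (4 * (2 + tau)).
have t2 : 0 < 2 + tau by rewrite ltr_wpDr.
have e'0 : 0 < e' by rewrite divr_gt0 // mulr_gt0.
have e2 : 0 < e / 2 by rewrite divr_gt0.
have [N1 HN1] := cf nc _ e'0; have [N2 HN2] := cn nc _ e'0.
have [N3 HN3] := bsum_tail (rest_ge0 ^~ w) sr e2.
have [N4 HN4] := eventually_small Soo.
exists (maxn (maxn N1 N2) (maxn N3 N4)) => i k.
rewrite !geq_max => /andP[/andP[i1 i2] /andP[i3 i4]] ik sa.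
have sc : \sum_(i <= j < k) clock j w <= tau.
  apply: le_trans sa; apply: ler_sum_nat => j _.
  rewrite /clock; case: (small j w) => /=; first by rewrite mul1r.
  by rewrite mul0r.
have Wf := window_forget (ltW e'0) (clock_ge0 ^~ w) HN1 i1 ik sc.
have Wn := window_forget (ltW e'0) (clock_ge0 ^~ w) HN2 i2 ik sc.
have e'E : (2 + tau) * e' = e / 4 by rewrite /e'; field; rewrite gt_eqF.
rewrite e'E in Wf Wn.
have Rr : `|\sum_(i <= j < k) (a j.+1 w * (x j w - m j w) - (far_noise j w + near_noise j w))|
    <= e / 2.
  apply: (le_trans (ler_norm_sum _ _ _)); apply: le_trans (HN3 i k i3).
  apply: ler_sum_nat => j /andP[ij _]; apply: noise_split.
  exact: HN4 (leq_trans i4 ij).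
have -> : \sum_(i <= j < k) a j.+1 w * (x j w - m j w) =
  \sum_(i <= j < k) (a j.+1 w * (x j w - m j w) - (far_noise j w + near_noise j w)) +
  (\sum_(i <= j < k) far_noise j w + \sum_(i <= j < k) near_noise j w).
  by rewrite -!big_split /=; apply: eq_bigr => j _; rewrite subrK.
apply: (le_trans (ler_normD _ _)).
have := ler_normD (\sum_(i <= j < k) far_noise j w) (\sum_(i <= j < k) near_noise j w).
lra.
Qed.

End Coordinate.
End AdaptiveSteps.

(** * Euclidean norm and descent *)

Section Euclid.
Context (R : realType) (d : nat).
Implicit Types x y h : 'rV[R]_d.

Definition dot x y : R := \sum_(i < d) x ord0 i * y ord0 i.

Lemma l2norm_ge0 x : 0 <= l2norm x. Proof. exact: sqrtr_ge0. Qed.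

Lemma l2norm_sqr x : l2norm x ^+ 2 = \sum_(i < d) x ord0 i ^+ 2.
Proof. by rewrite sqr_sqrtr //; apply: sumr_ge0 => i _; exact: sqr_ge0. Qed.

Lemma coord_le_l2norm x i : `|x ord0 i| <= l2norm x.
Proof.
rewrite -ler_sqr ?nnegrE ?l2norm_ge0 // real_normK ?num_real // l2norm_sqr.
rewrite (bigD1 i) //= lerDl; apply: sumr_ge0 => j _; exact: sqr_ge0.
Qed.

Lemma l2norm_le_sum x : l2norm x <= \sum_(i < d) `|x ord0 i|.
Proof.
have s0 : 0 <= \sum_(i < d) `|x ord0 i| by apply: sumr_ge0.
rewrite -ler_sqr ?nnegrE ?l2norm_ge0 // l2norm_sqr expr2 mulr_suml.
apply: ler_sum => i _; rewrite -[leLHS]real_normK ?num_real // expr2.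
by apply: ler_wpM2l => //; rewrite (bigD1 i) //= lerDl sumr_ge0.
Qed.

Lemma dot_le x y : `|dot x y| <= l2norm x * l2norm y.
Proof.
rewrite -ler_sqr ?nnegrE ?mulr_ge0 ?l2norm_ge0 // real_normK ?num_real // exprMn.
have [y0|] := eqVneq (l2norm y) 0.
  have y00 i : y ord0 i = 0.
    by have := coord_le_l2norm y i; rewrite y0 normr_le0 => /eqP.
  rewrite /dot big1 => [|i _]; last by rewrite y00 mulr0.
  by rewrite expr0n /=; apply: mulr_ge0; exact: sqr_ge0.
move=> yn0; have y2 : 0 < l2norm y ^+ 2 by rewrite exprn_gt0 // lt0r yn0 l2norm_ge0.
have : 0 <= \sum_(i < d) (l2norm y ^+ 2 * x ord0 i - dot x y * y ord0 i) ^+ 2.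
  by apply: sumr_ge0 => i _; exact: sqr_ge0.
have -> : \sum_(i < d) (l2norm y ^+ 2 * x ord0 i - dot x y * y ord0 i) ^+ 2 =
   l2norm y ^+ 2 * (l2norm x ^+ 2 * l2norm y ^+ 2 - dot x y ^+ 2).
  transitivity (\sum_(i < d) (l2norm y ^+ 4 * x ord0 i ^+ 2 +
      dot x y ^+ 2 * y ord0 i ^+ 2 - 2 * l2norm y ^+ 2 * dot x y * (x ord0 i * y ord0 i))).
    by apply: eq_bigr => i _; ring.
  rewrite sumrB big_split /= -!mulr_sumr -!l2norm_sqr -/(dot x y); ring.
by rewrite pmulr_rge0 // subr_ge0.
Qed.

Lemma l2normD x y : l2norm (x + y) <= l2norm x + l2norm y.
Proof.
rewrite -ler_sqr ?nnegrE ?addr_ge0 ?l2norm_ge0 //.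
have -> : l2norm (x + y) ^+ 2 = l2norm x ^+ 2 + l2norm y ^+ 2 + 2 * dot x y.
  rewrite !l2norm_sqr /dot mulr_sumr -!big_split /=; apply: eq_bigr => i _.
  by rewrite !mxE; ring.
have := le_trans (ler_norm _) (dot_le x y); nra.
Qed.

Lemma l2normZ (k : R) x : l2norm (k *: x) = `|k| * l2norm x.
Proof.
rewrite /l2norm -sqrtr_sqr -sqrtrM ?sqr_ge0 // mulr_sumr; congr Num.sqrt.
by apply: eq_bigr => i _; rewrite mxE exprMn.
Qed.

Lemma dotDl x y z : dot (x + y) z = dot x z + dot y z.
Proof. by rewrite /dot -big_split; apply: eq_bigr => i _; rewrite mxE mulrDl. Qed.

Lemma derive_grad (g : 'rV[R]_d -> R) x h : differentiable g x ->
  'D_h g x = dot (grad g x) h.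
Proof.
move=> dg; rewrite deriveE // {1}(row_sum_delta h) linear_sum /=.
by apply: eq_bigr => i _; rewrite linearZ /= -deriveE // mxE mulrC.
Qed.

(** Mean value theorem along the segment; the constant L in place of L / 2 is
    harmless. *)
Lemma descent (g : 'rV[R]_d -> R) (L : R) x h : 0 <= L ->
  (forall y, differentiable g y) -> l2_lipschitz L (grad g) ->
  g (x + h) <= g x + dot (grad g x) h + L * l2norm h ^+ 2.
Proof.
move=> L0 dg lip.
pose phi (t : R) : R := g (x + t *: h).
have quot t : (fun e : R => e^-1 *: (phi (e *: 1 + t) - phi t)) =
    (fun e : R => e^-1 *: (g (e *: h + (x + t *: h)) - g (x + t *: h))).
  apply/funext => e; rewrite /phi; congr (_ *: (g _ - _)).
  by rewrite [e *: 1]mulr1 scalerDl addrCA.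
have dphi (t : R) : is_derive t 1 phi ('D_h g (x + t *: h)).
  have := @diff_derivable _ _ _ g (x + t *: h) h (dg _).
  rewrite /derivable => cv; split; first by rewrite /derivable /= quot.
  by rewrite /derive /= quot.
have [|c c01] := @MVT_segment R phi (fun t => 'D_h g (x + t *: h)) 0 1 ler01 (fun t _ => dphi t).
  by apply: derivable_within_continuous => t _; case: (dphi t).
rewrite subr0 mulr1 /phi scale1r scale0r addr0 derive_grad // => E.
have -> : g (x + h) = g x + dot (grad g (x + c *: h)) h by rewrite -E [RHS]addrC subrK.
rewrite -addrA lerD2l.
have -> : dot (grad g (x + c *: h)) h =
   dot (grad g x) h + dot (grad g (x + c *: h) - grad g x) h.
  by rewrite -dotDl [grad g x + _]addrC subrK.
rewrite lerD2l; apply: (le_trans (ler_norm _)); apply: (le_trans (dot_le _ _)).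
rewrite expr2 mulrA; apply: ler_wpM2r; first exact: l2norm_ge0.
apply: (le_trans (lip _ _)); apply: ler_wpM2l => //.
rewrite addrC addKr l2normZ; move: c01; rewrite in_itv /= => /andP[c0 c1].
by rewrite ger0_norm // ler_piMl // l2norm_ge0.
Qed.

End Euclid.

(** * AdaGrad-Norm *)

(** The smallness conditions on the step beyond which near terms are considered:
    jumps carry at most half of the second moment, and the quadratic terms in the
    fourth-moment step are a small part of the drift. *)
Lemma exists_small_step (R : realType) (kappa r C : R) : 0 < kappa -> 0 < r -> 0 < C ->
  exists eta : R, [/\ 0 < eta, eta <= 2^-1, kappa * eta `^ r <= 2^-1 & 8 * C * eta <= 1].
Proof.
move=> k0 r0 C0.
pose e1 := (2^-1 / kappa) `^ r^-1.
have e10 : 0 < e1 by rewrite powR_gt0 // divr_gt0.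
pose e2 := (8 * C)^-1.
have e20 : 0 < e2 by rewrite invr_gt0 mulr_gt0.
exists (Num.min 2^-1 (Num.min e1 e2)); split.
- by rewrite !lt_min invr_gt0 ltr0Sn e10 e20.
- by rewrite ge_min lexx.
- rewrite mulrC -ler_pdivlMr //.
  have -> : 2^-1 / kappa = e1 `^ r.
    rewrite /e1 -powRrM mulVf ?gt_eqF // powRr1 // divr_ge0 // ?invr_ge0 //; exact: ltW.
  apply: ge0_ler_powR; rewrite ?nnegrE ?(ltW r0) ?(ltW e10) //.
    by rewrite ltW // !lt_min invr_gt0 ltr0Sn e10 e20.
  by rewrite !ge_min lexx !orbT.
- rewrite -[leRHS](mulfV (lt0r_neq0 (mulr_gt0 (ltr0Sn _ 7) C0))).
  apply: ler_wpM2l; first by rewrite mulr_ge0 // ltW.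
  by rewrite !ge_min lexx !orbT.
Qed.

Section Windows.
Context (R : realType) (d : nat).
Variables (gamma : nat -> R) (eps : nat -> 'rV[R]_d) (T : R).
Hypothesis gamma0 : forall i, 0 <= gamma i.
Hypothesis T0 : 0 < T.

Let t := cumul gamma.

Lemma cumul_split n k : (n <= k)%N -> t k = t n + \sum_(n.+1 <= i < k.+1) gamma i.
Proof. by move=> nk; rewrite /t /cumul (@big_cat_nat _ _ _ n.+1). Qed.

Lemma cumul_le n k : (n <= k)%N -> t n <= t k.
Proof. by move=> nk; rewrite (cumul_split nk) lerDl; apply: sumr_ge0. Qed.

(** Valid also when the maximum is infinite: otherwise all indices with t j <= b are
    below k, by monotonicity, and the maximum is at most k - 1. *)
Lemma le_max_index k (b : R) : (k%:R%:E <= max_index t b)%E -> t k <= b.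
Proof.
move=> kb; rewrite leNgt; apply/negP => bk; move: kb; rewrite leNgt => /negP; apply.
have H : (max_index t b <= (k%:R - 1)%:E)%E.
  apply: ge_ereal_sup => _ [j /= tj <-]; rewrite lee_fin.
  have jk : (j < k)%N.
    by rewrite ltnNge; apply/negP => kj; have := cumul_le kj; lra.
  by rewrite lerBrDr natr1 ler_nat.
by apply: (le_lt_trans H); rewrite lte_fin; lra.
Qed.

Lemma window_sup_cvg0 :
  (forall e, 0 < e -> exists N, forall n k, (N <= n)%N -> (n <= k)%N ->
    \sum_(n.+1 <= i < k.+1) gamma i <= T ->
    l2norm (\sum_(n <= i < k.+1) gamma i *: eps i) <= e) ->
  window_sup gamma eps T n @[n --> \oo] --> 0%E.
Proof.
move=> H.
have ge0 n : (0 <= window_sup gamma eps T n)%E.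
  apply: (@le_trans _ _ (l2norm (\sum_(n <= i < n.+1) gamma i *: eps i))%:E).
    by rewrite lee_fin l2norm_ge0.
  apply: ereal_sup_ubound; exists n => //; split => //.
  by apply: ereal_sup_ubound; exists n => //=; rewrite lerDl ltW.
have le n (e : R) : (forall k, (n <= k)%N -> \sum_(n.+1 <= i < k.+1) gamma i <= T ->
     l2norm (\sum_(n <= i < k.+1) gamma i *: eps i) <= e) ->
    (window_sup gamma eps T n <= e%:E)%E.
  move=> He; apply: ge_ereal_sup => _ [k /= [nk kmax] <-]; rewrite lee_fin.
  apply: He => //; have := le_max_index kmax.
  by rewrite -/t (cumul_split nk) lerD2l.
apply/fine_cvgP; split.
  have [N HN] := H 1 ltr01; exists N => // n /= Nn.
  rewrite ge0_fin_numE //; apply: (@le_lt_trans _ _ 1%:E); last exact: ltry.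
  by apply: le => k nk; exact: HN.
apply/cvgrPdist_le => e e0; have [N HN] := H e e0; exists N => // n /= Nn.
have ub : (window_sup gamma eps T n <= e%:E)%E by apply: le => k nk; exact: HN.
have fin : window_sup gamma eps T n \is a fin_num.
  by rewrite ge0_fin_numE //; apply: (le_lt_trans ub); exact: ltry.
rewrite sub0r normrN ger0_norm; last exact: fine_ge0.
by rewrite -lee_fin fineK.
Qed.

End Windows.

Section VectorMeasurability.
Context (R : realType) (d : nat) (disp : measure_display) (Omega : measurableType disp).

Lemma measurable_l2norm (A : set (set Omega)) (X : Omega -> 'rV[R]_d) :
  sub_measurable_vec A X -> sub_measurable A (fun w => l2norm (X w)).
Proof.
move=> mX; rewrite (_ : (fun w => _) =
    fun w => (\sum_(i < d) X w ord0 i ^+ 2) `^ 2^-1); last first.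
  apply/funext => w; rewrite powR12_sqrt //.
  by apply: sumr_ge0 => i _; exact: sqr_ge0.
apply: (measurableT_comp (@measurable_powR R 2^-1)).
by apply: measurable_sum => i; apply: measurable_funX; exact: mX.
Qed.

Lemma integral_natr_bool (P : probability Omega R) (B : set Omega) (b : Omega -> bool)
    (W : Omega -> R) :
  (\int[P]_(w in B) ((b w)%:R * W w)%:E = \int[P]_(w in B `&` [set w | b w]) (W w)%:E)%E.
Proof.
rewrite [LHS]integral_mkcond [RHS]integral_mkcond; apply: eq_integral => w _.
rewrite !patchE in_setI; case: ifP => //= wB; case: (boolP (b w)) => bw /=.
  by rewrite mem_set //= mul1r.
by rewrite memNset //= ?mul0r //; exact/negP.
Qed.

End VectorMeasurability.

Section AdaGradNorm.
Context (R : realType) (d : nat) (disp : measure_display) (Omega : measurableType disp)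
  (P : probability Omega R).
Variables (g : 'rV[R]_d -> R) (F : nat -> set (set Omega))
  (G theta : nat -> Omega -> 'rV[R]_d) (S : nat -> Omega -> R)
  (theta1 : 'rV[R]_d) (S0 alpha0 L beta sigma delta0 rho kappa : R)
  (E2 E2rho : nat -> Omega -> \bar R).
Hypothesis g_diff : forall x, differentiable g x.
Hypothesis g_ge0 : forall x, 0 <= g x.
Hypothesis F_filtration : filtration F.
Hypothesis S_meas : forall n, sub_measurable (F n) (S n).
Hypothesis G_meas : forall n, sub_measurable_vec (F n.+1) (G n.+1).
Hypothesis S0_gt0 : 0 < S0.
Hypothesis alpha0_gt0 : 0 < alpha0.
Hypothesis theta_init : forall w, theta 1%N w = theta1.
Hypothesis S_init : forall w, S 0%N w = S0.
Hypothesis S_rec : forall n w, S n.+1 w = S n w + l2norm (G n.+1 w) ^+ 2.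
Hypothesis theta_rec : forall n w,
  theta n.+2 w = theta n.+1 w - (alpha0 / Num.sqrt (S n.+1 w)) *: G n.+1 w.
Hypothesis L_gt0 : 0 < L.
Hypothesis g_smooth : l2_lipschitz L (grad g).
Hypothesis G_unbiased : forall n,
  is_cond_exp_vec P (F n) (G n.+1) (fun w => grad g (theta n.+1 w)).
Hypothesis E2_version : forall n,
  is_cond_exp_ge0 P (F n) (fun w => l2norm (G n.+1 w) ^+ 2) (E2 n.+1).
Hypothesis beta_ge0 : 0 <= beta.
Hypothesis G_affine : forall n, {ae P, forall w,
  (E2 n.+1 w <= (beta * l2norm (grad g (theta n.+1 w)) ^+ 2 + sigma ^+ 2)%:E)%E}.
Hypothesis delta0_gt0 : 0 < delta0.
Hypothesis rho_gt0 : 0 < rho.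
Hypothesis E2rho_version : forall n,
  is_cond_exp_ge0 P (F n) (fun w => l2norm (G n.+1 w) `^ (2 + rho)) (E2rho n.+1).
Hypothesis G_local : {ae P, forall w, forall n,
  l2norm (grad g (theta n.+1 w)) <= delta0 -> (E2rho n.+1 w <= kappa%:E * E2 n.+1 w)%E}.

Let u n w := l2norm (grad g (theta n.+1 w)).
Let v n w := l2norm (G n.+1 w).
(* Indices are shifted by one: at time n the point theta n.+1 is known and G n.+1 is
   not.  The summand 1 in s makes the weight beta u^2 + s positive. *)
Let s := sigma ^+ 2 + 1.
Let r := Num.min rho 1.
Let kappa' := 1 + `|kappa|.

Let sF n : sigma_algebra setT (F n). Proof. by case: F_filtration. Qed.
Let Fm n : F n `<=` measurable. Proof. by case: F_filtration. Qed.
Let s0 : 0 < s. Proof. by rewrite /s ltr_wpDl // sqr_ge0. Qed.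
Let r_gt0 : 0 < r. Proof. by rewrite /r lt_min rho_gt0 ltr01. Qed.
Let r_le1 : r <= 1. Proof. by rewrite /r ge_min lexx orbT. Qed.
Let u0 n w : 0 <= u n w. Proof. exact: l2norm_ge0. Qed.
Let v0 n w : 0 <= v n w. Proof. exact: l2norm_ge0. Qed.

Let mgrad n : sub_measurable_vec (F n) (fun w => grad g (theta n.+1 w)).
Proof. by move=> i; case: (G_unbiased n i). Qed.
Let mu n : sub_measurable (F n) (u n).
Proof. exact: measurable_l2norm (@mgrad n). Qed.
Let mv n : sub_measurable (F n.+1) (v n).
Proof. exact: measurable_l2norm (@G_meas n). Qed.
Let tu n : measurable_fun setT (u n). Proof. exact: (sub_measurableW (sF n) (@Fm n)). Qed.
Let tv n : measurable_fun setT (v n).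
Proof. exact: (sub_measurableW (sF n.+1) (@Fm n.+1)). Qed.
Let tvpow n (q : R) : measurable_fun setT (fun w => v n w `^ q).
Proof. exact: (measurableT_comp (@measurable_powR R q) (@tv n)). Qed.
Let h0 n w : 0 <= beta * u n w ^+ 2 + s.
Proof. by rewrite addr_ge0 ?mulr_ge0 ?sqr_ge0 // ltW. Qed.

Let moment2 n (Z : Omega -> R) : sub_measurable (F n) Z -> (forall w, 0 <= Z w) ->
  (mean P (fun w => Z w * v n w ^+ 2)%R <= mean P (fun w => Z w * (beta * u n w ^+ 2 + s))%R)%E.
Proof.
move=> mZ Z0; rewrite !meanE; apply: (test_le (sF n) (@Fm n)) => //.
- by mfun.
- by mfun.
- by move=> w; exact: sqr_ge0.
move=> B FB; have [_ mE2 E20 <- //] := E2_version n.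
have mB : measurable B by exact: Fm FB.
have tE2 : measurable_fun setT (E2 n.+1) by exact: (sub_measurableW (sF n) (@Fm n)).
apply: ae_ge0_le_integral => //.
- exact: measurable_funTS.
- by move=> w _; rewrite lee_fin.
- by apply: measurable_funTS; apply/measurable_EFinP; mfun.
apply: filterS (G_affine n) => w H _; apply: (le_trans H).
by rewrite lee_fin /s addrA lerDl.
Qed.

(** Lowering the exponent from rho to r = min(rho, 1) costs v^(2+r) <= v^2 + v^(2+rho),
    whence the constant 1 + |kappa|. *)
Let moment_local n (Z : Omega -> R) : sub_measurable (F n) Z -> (forall w, 0 <= Z w) ->
  (mean P (fun w => Z w * ((flat u delta0 n w)%:R * (v n w ^+ 2 * v n w `^ r)))%R <=
   mean P (fun w => kappa' * (Z w * ((flat u delta0 n w)%:R * v n w ^+ 2)))%R)%E.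
Proof.
move=> mZ Z0.
have mflat : sub_measurable (F n) (flat u delta0 n).
  exact: (measurable_fun_ler (@mu n) (measurable_cst _)).
have tflat : measurable_fun setT (fun w => (flat u delta0 n w)%:R : R).
  by apply: measurable_natr_bool; exact: (sub_measurableW (sF n) (@Fm n)).
have k'0 : 0 <= kappa' by rewrite addr_ge0.
have vr : forall w, 0 <= v n w `^ r by move=> w; exact: powR_ge0.
have tr := tvpow n r; have trho := tvpow n (2 + rho).
rewrite [leRHS](eq_mean P (g := fun w => Z w * (kappa' * ((flat u delta0 n w)%:R * v n w ^+ 2))));
  last by move=> w; rewrite mulrCA.
pose X w := (flat u delta0 n w)%:R * (v n w ^+ 2 * v n w `^ r).
pose Y w := kappa' * ((flat u delta0 n w)%:R * v n w ^+ 2).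
have tX : measurable_fun setT X by rewrite /X; mfun.
have tY : measurable_fun setT Y by rewrite /Y; mfun.
have fl0 w : 0 <= (flat u delta0 n w)%:R :> R by exact: ler0n.
have X0 w : 0 <= X w by rewrite /X; nonneg.
have Y0 w : 0 <= Y w by rewrite /Y; nonneg.
rewrite !meanE; apply: (test_le (sF n) (@Fm n) tX tY X0 Y0 _ mZ Z0) => B FB.
pose C := B `&` [set w | flat u delta0 n w].
have FC : F n C.
  rewrite -(measurable_g_measurableTypeE (sF n)); apply: measurableI.
    by rewrite (measurable_g_measurableTypeE (sF n)).
  by have := mflat measurableT [set true] I; rewrite setTI.
have mC : measurable C by exact: Fm FC.
have [_ mE2 E20 E2E] := E2_version n.
have [_ mE2r E2r0 E2rE] := E2rho_version n.
have tE2 : measurable_fun setT (E2 n.+1) by exact: (sub_measurableW (sF n) (@Fm n)).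
have tE2r : measurable_fun setT (E2rho n.+1) by exact: (sub_measurableW (sF n) (@Fm n)).
have tv2 : measurable_fun setT (fun w => v n w ^+ 2) by mfun.
rewrite integral_natr_bool -/C.
have YE : (\int[P]_(w in B) (Y w)%:E = kappa'%:E * \int[P]_(w in C) (v n w ^+ 2)%:E)%E.
  rewrite -ge0_integralZl_EFin //; first last.
  - by apply: measurable_funTS; exact/measurable_EFinP.
  - by move=> w _; rewrite lee_fin sqr_ge0.
  rewrite /C; under [in RHS]eq_integral do rewrite -EFinM.
  by rewrite -integral_natr_bool; apply: eq_integral => w _; rewrite /Y mulrCA.
rewrite YE.
have pt w : v n w ^+ 2 * v n w `^ r <= v n w ^+ 2 + v n w `^ (2 + rho).
  have [v1|v1] := leP (v n w) 1.
    rewrite ler_wpDr ?powR_ge0 // ler_piMr ?sqr_ge0 //.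
    have <- : (1 : R) `^ r = 1 by rewrite powR1.
    by apply: ge0_ler_powR; rewrite ?nnegrE // ltW.
  have vn0 : v n w != 0 by rewrite gt_eqF // (lt_trans ltr01).
  rewrite ler_wpDl ?sqr_ge0 // powRD ?vn0 ?implybT // powR_mulrn //.
  apply: ler_wpM2l; first exact: sqr_ge0.
  by apply: ler_powR; [exact: ltW | rewrite /r ge_min lexx].
apply: (@le_trans _ _ (\int[P]_(w in C) ((v n w ^+ 2)%:E + (v n w `^ (2 + rho))%:E))%E).
  apply: ge0_le_integral => //.
  - by move=> w _; rewrite lee_fin mulr_ge0 ?sqr_ge0.
  - by apply: measurable_funTS; apply/measurable_EFinP; mfun.
  - by apply: measurable_funTS; apply: emeasurable_funD; exact/measurable_EFinP.
  - by move=> w _; rewrite -EFinD lee_fin.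
rewrite ge0_integralD //; first last.
- by apply: measurable_funTS; exact/measurable_EFinP.
- by move=> w _; rewrite lee_fin powR_ge0.
- by apply: measurable_funTS; exact/measurable_EFinP.
- by move=> w _; rewrite lee_fin sqr_ge0.
rewrite /kappa' EFinD ge0_muleDl ?lee_fin // mul1e; apply: leeD => //.
rewrite -(E2rE _ FC) -(E2E _ FC) -ge0_integralZl_EFin //; last exact: measurable_funTS.
apply: ae_ge0_le_integral => //.
- exact: measurable_funTS.
- by move=> w _; rewrite mule_ge0 ?lee_fin.
- by apply: measurable_funTS; apply: measurable_funeM.
apply: filterS G_local => w H [_ /= fl]; apply: (le_trans (H n fl)).
by apply: lee_wpmul2r => //; rewrite lee_fin ler_norm.
Qed.

Let a := step S.

Let Srec n w : S n.+1 w = S n w + v n w ^+ 2. Proof. exact: S_rec. Qed.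
Let a_gt0 n w : 0 < a n w. Proof. exact: (step_gt0 S_init S0_gt0 Srec). Qed.

Let move_eq n w : theta n.+2 w = theta n.+1 w + (- (alpha0 * a n.+1 w)) *: G n.+1 w.
Proof. by rewrite theta_rec scaleNr. Qed.

(* A single stochastic gradient is at most the root of the new sum of squares, so
   that the iterates move by at most alpha0 and their gradients are bounded at each
   time by a constant. *)
Let av_le1 n w : a n.+1 w * v n w <= 1.
Proof.
have S1 := S_gt0 S_init S0_gt0 Srec n.+1 w.
have av0 : 0 <= a n.+1 w * v n w by rewrite mulr_ge0 // ltW.
rewrite -(@expr_le1 _ 2) // exprMn (step_sqr S_init S0_gt0 Srec) mulrC.
by rewrite ler_pdivrMr // mul1r Srec lerDr ltW // (S_gt0 S_init S0_gt0 Srec).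
Qed.

Let move_norm n w : l2norm (theta n.+2 w - theta n.+1 w) = alpha0 * (a n.+1 w * v n w).
Proof.
rewrite move_eq addrC addKr l2normZ normrN ger0_norm ?mulrA //.
by rewrite mulr_ge0 // ltW.
Qed.

Let u_growth n w : u n.+1 w <= u n w + L * alpha0 * a n.+1 w * v n w.
Proof.
have -> : L * alpha0 * a n.+1 w * v n w = L * (alpha0 * (a n.+1 w * v n w)) by ring.
rewrite -move_norm /u.
have -> : grad g (theta n.+2 w) = grad g (theta n.+1 w) +
   (grad g (theta n.+2 w) - grad g (theta n.+1 w)) by rewrite [RHS]addrC subrK.
by apply: (le_trans (l2normD _ _)); rewrite lerD2l; exact: g_smooth.
Qed.

Let u_bd n : exists U, forall w, u n w <= U.
Proof.
elim: n => [|n [U HU]]; first by exists (l2norm (grad g theta1)) => w; rewrite /u theta_init.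
exists (U + L * alpha0) => w; apply: (le_trans (u_growth n w)); apply: lerD => //.
rewrite -mulrA ler_piMr // mulr_ge0 //; exact: ltW.
Qed.

Let v2_fin n : (mean P (fun w => v n w ^+ 2)%R < +oo)%E.
Proof.
have := @moment2 n (fun=> 1) (measurable_cst _) (fun=> ler01).
have -> : mean P (fun w => 1 * v n w ^+ 2) = mean P (fun w => v n w ^+ 2).
  by apply: eq_mean => w; rewrite mul1r.
move/le_lt_trans; apply.
have [U HU] := u_bd n.
apply: (@le_lt_trans _ _ (mean P (fun=> beta * U ^+ 2 + s))); last by rewrite mean_cst ltry.
apply: mean_le; [by mfun|by mfun|by move=> w; rewrite mul1r|].
move=> w; rewrite mul1r lerD2r; apply: ler_wpM2l => //.
by rewrite ler_sqr ?nnegrE //; exact: le_trans (HU w).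
Qed.

Let tcoord n (i : 'I_d) : sub_measurable (F n.+1) (fun w => G n.+1 w ord0 i).
Proof. exact: G_meas. Qed.

Let unbiased i n (Z : Omega -> R) : sub_measurable (F n) Z ->
  P.-integrable setT (fun w => (Z w * G n.+1 w ord0 i)%:E) ->
  P.-integrable setT (fun w => (Z w * grad g (theta n.+1 w) ord0 i)%:E) ->
  (\int[P]_w (Z w * G n.+1 w ord0 i)%:E =
   \int[P]_w (Z w * grad g (theta n.+1 w) ord0 i)%:E)%E.
Proof. by move=> mZ; exact: (test_eq (sF n) (@Fm n) (G_unbiased n i)). Qed.

Let xv i n w : `|G n.+1 w ord0 i| <= v n w. Proof. exact: coord_le_l2norm. Qed.
Let mle i n w : `|grad g (theta n.+1 w) ord0 i| <= u n w. Proof. exact: coord_le_l2norm. Qed.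

Let energy : bsume (fun n => mean P (fun w => a n w ^+ 2 * u n w ^+ 2)).
Proof.
pose p n w := dot (grad g (theta n.+1 w)) (G n.+1 w).
have ma n : sub_measurable (F n) (a n) by exact: (measurable_step S_init S0_gt0 Srec S_meas).
apply: (energy_summable F_filtration S_init S0_gt0 Srec u0 v0 S_meas mu mv beta_ge0 s0
  moment2 (g := fun n w => g (theta n.+1 w)) (p := p) (L := L) (alpha := alpha0)
  (g1 := g theta1) (u1 := l2norm (grad g theta1))) => //.
- exact: ltW.
- by move=> w; rewrite theta_init.
- by move=> w; rewrite /u theta_init.
- by move=> n w; exact: dot_le.
- move=> n w; rewrite move_eq.
  apply: (le_trans (descent _ _ (ltW L_gt0) g_diff g_smooth)).
  have -> : dot (grad g (theta n.+1 w)) (- (alpha0 * a n.+1 w) *: G n.+1 w) =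
      - (alpha0 * a n.+1 w * p n w).
    rewrite /p /dot mulr_sumr -sumrN; apply: eq_bigr => i _.
    by rewrite [X in _ * X]mxE; ring.
  rewrite l2normZ exprMn real_normK ?num_real // sqrrN exprMn.
  by rewrite le_eqVlt; apply/orP; left; apply/eqP; rewrite -/a -/(v n w); ring.
- move=> n.
  pose N (i : 'I_d) w := - a n w ^+ 2 * grad g (theta n.+1 w) ord0 i *
    (G n.+1 w ord0 i - grad g (theta n.+1 w) ord0 i).
  have cN i : centered P (N i).
    have [U HU] := u_bd n.
    have mgi : sub_measurable (F n) (fun w => grad g (theta n.+1 w) ord0 i) by exact: mgrad.
    have aU w : `|- a n w ^+ 2 * grad g (theta n.+1 w) ord0 i| <= step0 S0 ^+ 2 * U.
      rewrite normrM normrN (ger0_norm (sqr_ge0 (a n w))); apply: ler_pM; rewrite ?sqr_ge0 //.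
        rewrite ler_sqr ?nnegrE ?(ltW (a_gt0 _ _)) //.
          exact: (step_le0 S_init S0_gt0 Srec).
        by rewrite invr_ge0 sqrtr_ge0.
      exact: le_trans (mle i n w) (HU w).
    have mW : sub_measurable (F n) (fun w => - a n w ^+ 2 * grad g (theta n.+1 w) ord0 i).
      apply: measurable_funM => //; apply: measurableT_comp => //; by mfun.
    have fin : (mean P (fun=> (step0 S0 ^+ 2 * U) ^+ 2)%R < +oo)%E by rewrite mean_cst ltry.
    exact: (centered_noise F_filtration u0 mu mv v2_fin u_bd (fun n => @tcoord n i)
      (fun n => @mgrad n i) (xv i) (mle i) (@unbiased i) mW (measurable_cst _) aU fin).
  have := centered_sum (index_enum 'I_d) cN.
  rewrite (_ : (fun w => \sum_(i <- index_enum 'I_d) N i w) =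
    (fun w => a n w ^+ 2 * (u n w ^+ 2 - p n w))) //.
  apply/funext => w; rewrite /u l2norm_sqr /p /dot -sumrB mulr_sumr.
  by apply: eq_bigr => i _; rewrite /N; ring.
Qed.

(** One null set serves all coordinates, of which there are finitely many. *)
Lemma adagrad_noise_window : {ae P, forall w, S n w @[n --> \oo] --> +oo ->
  forall i : 'I_d, forall tau e, 0 <= tau -> 0 < e -> exists N, forall j k, (N <= j)%N ->
    (j <= k)%N -> \sum_(j <= l < k) a l w <= tau ->
    `|\sum_(j <= l < k) a l.+1 w *
        (G l.+1 w ord0 i - grad g (theta l.+1 w) ord0 i)| <= e}.
Proof.
have C0 : 0 < beta * delta0 ^+ 2 + s by rewrite ltr_wpDl // mulr_ge0 ?sqr_ge0.
have k0 : 0 < kappa' by rewrite ltr_pwDl.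
have [eta [eta0 eta_half eta_kappa eta_C0]] := exists_small_step k0 r_gt0 C0.
have H (i : 'I_d) := noise_window F_filtration S_init S0_gt0 Srec u0 v0 S_meas mu mv beta_ge0 s0
  v2_fin moment2 delta0_gt0 energy r_gt0 r_le1 (ltW k0) moment_local eta0 eta_half eta_kappa
  eta_C0 u_bd (fun n => @tcoord n i) (fun n => @mgrad n i) (xv i) (mle i) (@unbiased i).
by apply: filterS (filter_forall _ H) => w Hw Soo i; exact: Hw.
Qed.

Lemma adagrad_window_sup (T : R) : 0 < T -> {ae P, forall w, S n w @[n --> \oo] --> +oo ->
  window_sup (stepsize alpha0 (S ^~ w)) (fun i => G i w - grad g (theta i w)) T n
    @[n --> \oo] --> 0%E}.
Proof.
move=> T0; apply: filterS adagrad_noise_window => w H Soo.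
have gammaE n : stepsize alpha0 (S ^~ w) n = alpha0 * a n w by [].
have al0 := ltW alpha0_gt0; have a0 n : 0 <= a n w by exact: ltW.
apply: window_sup_cvg0 => // [n|e e0]; first by rewrite gammaE mulr_ge0.
(* The length of a window leaves out its first step, and the predictable steps lag
   one index behind the actual ones, hence the two extra steps. *)
pose tau := 2 * step0 S0 + T / alpha0.
have st0 : 0 <= step0 S0 by rewrite invr_ge0 sqrtr_ge0.
have tau0 : 0 <= tau.
  by apply: addr_ge0; [exact: mulr_ge0 | apply: divr_ge0; exact: ltW].
(* d.+1 avoids a division by zero in dimension 0 *)
pose e' := e / (alpha0 * d.+1%:R).
have e'0 : 0 < e' by rewrite divr_gt0 // mulr_gt0.
have [N HN] := choice (fun i => H Soo i tau e' tau0 e'0).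
exists (\max_(i < d) N i).+1 => n k Nn nk win.
case: n Nn nk win => // n Nn nk win.
have ale := fun j => step_le0 S_init S0_gt0 Srec j w.
have clk : \sum_(n <= l < k) a l w <= tau.
  have nk' : (n <= k)%N by exact: ltnW.
  apply: (@le_trans _ _ (\sum_(n <= l < k.+1) a l w)).
    by rewrite big_nat_recr //= lerDl.
  rewrite big_ltn ?ltnS // big_ltn ?ltnS //.
  have W : \sum_(n.+2 <= i < k.+1) a i w <= T / alpha0.
    by rewrite ler_pdivlMr // mulrC mulr_sumr.
  have := ale n; have := ale n.+1; rewrite /tau -/a; lra.
apply: (le_trans (l2norm_le_sum _)).
apply: (@le_trans _ _ (\sum_(i < d) alpha0 * e')).
  apply: ler_sum => i _; rewrite summxE.
  rewrite (_ : \sum_(n.+1 <= j < k.+1) _ = alpha0 * \sum_(n <= l < k) a l.+1 w *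
     (G l.+1 w ord0 i - grad g (theta l.+1 w) ord0 i)); last first.
    rewrite big_add1 /= mulr_sumr; apply: eq_bigr => l _.
    by rewrite !mxE gammaE mulrA.
  rewrite normrM (ger0_norm al0); apply: ler_wpM2l => //; apply: HN => //.
    by apply: leq_trans (leq_bigmax i) _.
  exact: ltnW.
rewrite sumr_const card_ord -mulr_natr /e'.
have d0 : 0 < d.+1%:R :> R by [].
rewrite (_ : alpha0 * (e / (alpha0 * d.+1%:R)) * d%:R = e * (d%:R / d.+1%:R)); last first.
  by field; rewrite !gt_eqF.
by rewrite ler_piMr ?(ltW e0) // ler_pdivrMr // mul1r ler_nat.
Qed.

End AdaGradNorm.

Theorem lemma14
  (R : realType) (d : nat) (g : 'rV[R]_d -> R)
  (gC1 : C1 g)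
  (g_lbound : has_lbound (range g)) (g_inf : inf (range g) = 0)
  (disp : measure_display) (Omega : measurableType disp)
  (P : probability Omega R)
  (F : nat -> set (set Omega)) (F_filtration : filtration F)
  (G theta : nat -> Omega -> 'rV[R]_d) (S : nat -> Omega -> R)
  (theta_meas : forall n, (1 <= n)%N -> sub_measurable_vec (F n.-1) (theta n))
  (S_meas : forall n, (1 <= n)%N -> sub_measurable (F n.-1) (S n.-1))
  (G_meas : forall n, (1 <= n)%N -> sub_measurable_vec (F n) (G n))
  (* AdaGrad-Norm recursion *)
  (theta1 : 'rV[R]_d) (S0 alpha0 : R) (S0_gt0 : 0 < S0) (alpha0_gt0 : 0 < alpha0)
  (theta_init : forall w, theta 1%N w = theta1)
  (S_init : forall w, S 0%N w = S0)
  (S_rec : forall n w, (1 <= n)%N ->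
     S n w = S n.-1 w + l2norm (G n w) ^+ 2)
  (theta_rec : forall n w, (1 <= n)%N ->
     theta n.+1 w = theta n w - (alpha0 / Num.sqrt (S n w)) *: G n w)
  (* global smoothness and non-flatness at infinity *)
  (L : R) (L_gt0 : 0 < L) (g_smooth : l2_lipschitz L (grad g))
  (g_nonflat : nonflat_at_infty g)
  (* conditional unbiasedness *)
  (G_unbiased : forall n, (1 <= n)%N ->
     is_cond_exp_vec P (F n.-1) (G n) (fun w => grad g (theta n w)))
  (* E2 n is a version of E[ |G_n|^2 | F_(n-1) ]; affine second-moment bound *)
  (E2 : nat -> Omega -> \bar R)
  (E2_version : forall n, (1 <= n)%N ->
     is_cond_exp_ge0 P (F n.-1) (fun w => l2norm (G n w) ^+ 2) (E2 n))
  (beta sigma : R) (beta_ge0 : 0 <= beta) (sigma_ge0 : 0 <= sigma)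
  (G_affine : forall n, (1 <= n)%N ->
     {ae P, forall w,
       (E2 n w <= (beta * l2norm (grad g (theta n w)) ^+ 2 + sigma ^+ 2)%:E)%E})
  (* E2rho n is a version of E[ |G_n|^(2+rho) | F_(n-1) ]; local condition *)
  (delta0 rho kappa : R) (delta0_gt0 : 0 < delta0) (rho_gt0 : 0 < rho)
  (E2rho : nat -> Omega -> \bar R)
  (E2rho_version : forall n, (1 <= n)%N ->
     is_cond_exp_ge0 P (F n.-1) (fun w => l2norm (G n w) `^ (2 + rho)) (E2rho n))
  (G_local : {ae P, forall w, forall n, (1 <= n)%N ->
     let Ln := [set w' | l2norm (grad g (theta n w')) <= delta0] in
     ((\1_Ln w)%:E * E2rho n w <= kappa%:E * ((\1_Ln w)%:E * E2 n w))%E}) :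
  forall T : R, 0 < T ->
    {ae P, forall w,
      S n w @[n --> \oo] --> +oo ->
      window_sup (stepsize alpha0 (S ^~ w))
        (fun i => G i w - grad g (theta i w)) T n @[n --> \oo] --> 0%E}.
Proof.
move=> T T0.
have g_ge0 x : 0 <= g x by rewrite -g_inf; apply: ge_inf => //; exists x.
have loc : {ae P, forall w, forall n, l2norm (grad g (theta n.+1 w)) <= delta0 ->
    (E2rho n.+1 w <= kappa%:E * E2 n.+1 w)%E}.
  apply: filterS G_local => w H n gd; have := H n.+1 (ltn0Sn n).
  by rewrite /= indicE mem_set //= !mul1e.
apply: (adagrad_window_sup gC1.1 g_ge0 F_filtration
  (fun n => S_meas n.+1 (ltn0Sn n)) (fun n => G_meas n.+1 (ltn0Sn n)) S0_gt0 alpha0_gt0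
  theta_init S_init (fun n w => S_rec n.+1 w (ltn0Sn n))
  (fun n w => theta_rec n.+1 w (ltn0Sn n)) L_gt0 g_smooth
  (fun n => G_unbiased n.+1 (ltn0Sn n)) (fun n => E2_version n.+1 (ltn0Sn n)) beta_ge0
  (fun n => G_affine n.+1 (ltn0Sn n)) delta0_gt0 rho_gt0
  (fun n => E2rho_version n.+1 (ltn0Sn n)) loc T0).
Qed.
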